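(* Among all renewal-type clearing policies whose cycle times have finite second moment, the optimal policy in terms of average cost is the optimal instantaneous rate policy. That is, if $M^*>0$ denotes the value of $M$ minimizing $\mathrm{AC}(\tau_M)$ over $M>0$, then for every stopping time $\tau$ of the filtration $\{\mathcal{G}_t\}$ with $\mathbb{E}[\tau]>0$ and $\mathbb{E}[\tau^2]<\infty$, $$\mathrm{AC}(\tau_{M^*})\le \mathrm{AC}(\tau).$$
   Context: Let $n\ge 1$, let $B_1,\dots,B_n$ be independent standard Brownian motions (started at $0$), and let $N_i(t)=D_it+\sigma_iB_i(t)$ with $D_i>0$, $\sigma_i>0$ for $i=1,\dots,n$ (cumulative demand of items of type $i$). Let $\{\mathcal{G}_t\}$ be the natural filtration, $\mathcal{G}_t$ being generated by $\{N_1(s),\dots,N_n(s):s\in[0,t]\}$. The cost parameters are: $A_D>0$ (fixed cost of a clearing), $c_i\in\mathbb{R}$ (unit transport cost for type $i$), $\omega_i>0$ (waiting cost per unit of type $i$ per unit time). A renewal-type clearing policy is given by its clearing cycle, a stopping time $\tau$ of $\{\mathcal{G}_t\}$ with $0<\mathbb{E}[\tau]<\infty$; its long-run average cost is $$\mathrm{AC}(\tau)=\frac{A_D+\mathbb{E}\left[\sum_{i=1}^nc_iN_i(\tau)\right]+\mathbb{E}\left[\sum_{i=1}^n\int_0^\tau\omega_iN_i(u)\,du\right]}{\mathbb{E}[\tau]}.$$ The instantaneous rate policy (IRP) with parameter $M>0$ has clearing cycle $\tau_M=\inf\{t>0:\sum_{i=1}^n\omega_iN_i(t)\ge M\}$.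 *)

(* Defs.v *)
From HB Require Import structures.
From mathcomp Require Import all_boot all_order all_algebra.
From mathcomp Require Import all_classical all_reals all_analysis.

Set Implicit Arguments.
Unset Strict Implicit.
Unset Printing Implicit Defensive.

Import Order.TTheory GRing.Theory Num.Theory.
Import numFieldNormedType.Exports.

Local Open Scope classical_set_scope.
Local Open Scope ring_scope.

Section probability_notions.
Context {d : measure_display} {T : measurableType d} {R : realType}.
Variable P : probability T R.

Definition mutually_independent {I : finType} (F : I -> set (set T)) : Prop :=
  forall (J : {set I}) (A : I -> set T), (forall i, i \in J -> F i (A i)) ->
    P (\bigcap_(i in [set` J]) A i) = (\prod_(i in J) P (A i))%E.

Definition generated_events {K : Type} (J : set K) (X : K -> T -> R) :
    set (set T) :=
  <<s \bigcup_(k in J) preimage_set_system setT (X k) measurable >>.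

(* Processes are indexed by the whole real line; only the times t >= 0 carry
   meaning, and all sample paths (not just almost all) are continuous there. *)
Record standard_brownian_motion (B : R -> T -> R) : Prop := {
  bm_measurable : forall t : R, 0 <= t -> measurable_fun setT (B t) ;
  bm_start : forall w, B 0 w = 0 ;
  bm_normal_increments : forall s t : R, 0 <= s -> s < t ->
    forall A : set R, measurable A ->
      P ((fun w => B t w - B s w) @^-1` A) = normal_prob 0 (Num.sqrt (t - s)) A ;
  bm_independent_increments : forall (k : nat) (t : nat -> R),
    0 <= t 0%N -> nondecreasing_seq t ->
    mutually_independent (fun j : 'I_k =>
      preimage_set_system setT (fun w => B (t j.+1) w - B (t j) w) measurable) ;
  bm_continuous : forall w, {within `[0, +oo[, continuous (fun t => B t w)} }.

Definition independent_processes {n : nat} (B : 'I_n -> R -> T -> R) : Prop :=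
  mutually_independent (fun i => generated_events `[0, +oo[ (B i)).

Definition demand {n : nat} (D sigma : 'I_n -> R) (B : 'I_n -> R -> T -> R)
    (i : 'I_n) (t : R) (w : T) : R :=
  D i * t + sigma i * B i t w.

Definition natural_filtration {n : nat} (N : 'I_n -> R -> T -> R) (t : R) :
    set (set T) :=
  generated_events [set p : 'I_n * R | 0 <= p.2 <= t] (fun p => N p.1 p.2).

Definition stopping_time (G : R -> set (set T)) (tau : T -> \bar R) : Prop :=
  (forall w, (0 <= tau w)%E) /\
  (forall t : R, 0 <= t -> G t [set w | (tau w <= t%:E)%E]).

(* For policies with finite mean cycle, tau is almost surely finite, so the
   value of [fine (tau w)] where tau w = +oo is irrelevant. *)
Definition average_cost {n : nat} (A_D : R) (c omega : 'I_n -> R)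
    (N : 'I_n -> R -> T -> R) (tau : T -> \bar R) : \bar R :=
  ((A_D%:E
    + 'E_P[fun w => (\sum_(i < n) c i * N i (fine (tau w)) w)%R]
    + 'E_P[fun w => (\sum_(i < n)
        \int[lebesgue_measure]_(u in `[0%R, fine (tau w)]) (omega i * N i u w))%R])
   / \int[P]_w tau w)%E.

Definition irp_cycle {n : nat} (omega : 'I_n -> R) (N : 'I_n -> R -> T -> R)
    (M : R) (w : T) : \bar R :=
  ereal_inf (EFin @` [set t : R | 0 < t /\ M <= \sum_(i < n) omega i * N i t w]).

End probability_notions.

(* Main.v *)
(* The total load is S(t) = a t + W(t), with a = sum_i omega_i D_i and W a Brownian motion of
   variance rate v = sum_i (omega_i sigma_i)^2.  For a stopping time tau with finite second moment,
     E S(tau) = a E tau   and   E S(tau)^2 = 2 a E int_0^tau S + v E tau,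
   so the expected holding cost is (E S(tau)^2 - v E tau) / (2 a).  By Jensen's inequality it is
   at least ((a E tau)^2 - v E tau) / (2 a), with equality for the hitting time of the level
   M = a E tau, where S(tau) is constant; this policy has the same mean cycle as tau, hence the same
   remaining costs, and the optimal instantaneous rate policy does at least as well.

   The two identities hold for the walk sampled on the dyadic grid of mesh 2^-m up to the first grid
   point after tau, since each increment is independent of the past.  They pass to the limit by
   dominated convergence, the bound being a maximal function of W up to time tau + 1, whose square
   is integrable by Doob's inequality. *)
Require Import Defs.
From HB Require Import structures.
From mathcomp Require Import all_boot all_order all_algebra.
From mathcomp Require Import all_classical all_reals all_analysis.
From mathcomp Require Import measurable_realfun ring lra.
Import Order.TTheory GRing.Theory Num.Theory.
Import numFieldNormedType.Exports.
Local Open Scope classical_set_scope.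
Local Open Scope ring_scope.

Set Implicit Arguments.
Unset Strict Implicit.
Unset Printing Implicit Defensive.

(** The second moment enters because the area under the load up to [tau] is at most of order
    [a tau^2 + tau max |W|]; Doob's inequality bounds the mean of [(max |W|)^2] by a multiple of
    [E tau + 1], so both terms are integrable. The policy used for comparison must satisfy the same
    hypotheses, hence hitting times of levels have to be shown square integrable. They are truncated
    at [k], where the identities apply at once, and the identities themselves bound the second
    moment independently of [k]. Brownian motion is given through increments at finitely many times,
    while the filtration is generated by all coordinates at uncountably many times. Pi-lambda
    arguments bridge the gap, one coordinate at a time, and integrals against past-measurable
    weights take the place of conditional expectations. *)

Section independence.
Context {d : measure_display} {T : measurableType d} {R : realType}.
Variable P : probability T R.

(** [C] is only a generating family. Changing the type of the domain to [g_sigma_algebraType C] lets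
    the general measurability lemmas for sums, products and compositions apply to sub-sigma-algebras
    unchanged. *)
Definition adapted (C : set (set T)) (h : T -> R) : Prop :=
  measurable_fun [set: g_sigma_algebraType C] (h : g_sigma_algebraType C -> R).

Definition independent_of (C : set (set T)) (Y : T -> R) : Prop :=
  forall A U, <<s C >> A -> measurable U ->
    P (A `&` Y @^-1` U) = (P A * P (Y @^-1` U))%E.

Lemma adapted_measurable C h :
  C `<=` measurable -> adapted C h -> measurable_fun [set: T] h.
Proof.
move=> Cm hh _ U mU; rewrite setTI.
apply: (smallest_sub (@sigma_algebra_measurable _ T) Cm).
by rewrite -[X in _ X]setTI; exact: hh.
Qed.

Lemma sigma_sub_measurable (C : set (set T)) : C `<=` measurable ->
  <<s C >> `<=` measurable.
Proof. exact: (smallest_sub (@sigma_algebra_measurable _ T)). Qed.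

(** Dynkin's argument: for a fixed [E], the product formula survives complements, by subtraction
    from [P E], and disjoint unions, by countable additivity. *)
Lemma pi_system_independent (C : set (set T)) (E : set T) :
  C `<=` measurable -> setI_closed C -> measurable E ->
  (forall A, C A -> P (A `&` E) = (P A * P E)%E) ->
  forall A, <<s C >> A -> P (A `&` E) = (P A * P E)%E.
Proof.
move=> Cm CI mE CE A sA.
suff: <<s C >> `<=` [set A | measurable A /\ P (A `&` E) = (P A * P E)%E].
  by move=> /(_ _ sA)[].
apply: lambda_system_subset => //; last by move=> B CB; split; [exact: Cm|exact: CE].
apply/dynkin_lambda_system; split.
- by split => //; rewrite setTI probability_setT mul1e.
- move=> B [mB BE]; split; first exact: measurableC.
  have -> : ~` B `&` E = E `\` (B `&` E).
    by apply/seteqP; split=> x /= [H1 H2]; split => //; [case|move=> Bx; apply: H2].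
  have -> : P (E `\` (B `&` E)) = (P E - P (B `&` E))%E.
    rewrite measureD//; [|exact: measurableI|by rewrite ltey_eq fin_num_measure].
    by rewrite (_ : E `&` (B `&` E) = B `&` E)// setICA setIid.
  rewrite BE probability_setC// -[X in (X - _)%E]mul1e -muleBl// ?fin_num_measure//.
- move=> F tF HF; split; first by apply: bigcupT_measurable => k; case: (HF k).
  have mF k : measurable (F k) by case: (HF k).
  rewrite setI_bigcupl.
  have -> : P (\bigcup_i (F i `&` E)) = (\sum_(0 <= k <oo) P (F k `&` E))%E.
    rewrite measure_bigcup//; last exact: trivIset_setIr.
      by apply: eq_eseriesl => k; rewrite in_setT.
    by move=> k _; exact: measurableI.
  have -> : P (\bigcup_i F i) = (\sum_(0 <= k <oo) P (F k))%E.
    by rewrite measure_bigcup//; apply: eq_eseriesl => k; rewrite in_setT.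
  transitivity (\sum_(0 <= k <oo) (P E * P (F k)))%E.
    by apply: eq_eseriesr => k _; rewrite (HF k).2 muleC.
  have PE : (fine (P E))%:E = P E by rewrite fineK ?fin_num_measure.
  by rewrite -PE nneseriesZl// muleC.
Qed.

(** Independence identifies the law of [(h, Y)] with the product of the marginal laws, since the two
    agree on rectangles. Tonelli then gives integrability of the product from that of the factors,
    and Fubini its integral. *)
Lemma independent_product (C : set (set T)) (h Y : T -> R) :
  C `<=` measurable -> adapted C h -> measurable_fun [set: T] Y ->
  independent_of C Y ->
  P.-integrable setT (EFin \o h) -> P.-integrable setT (EFin \o Y) ->
  P.-integrable setT (fun w => (h w * Y w)%:E) /\
  \int[P]_w (h w * Y w) = \int[P]_w h w * \int[P]_w Y w.
Proof.
move=> Cm hh mY indep ih iY.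
have mh := adapted_measurable Cm hh.
pose hm := [the {mfun T >-> R} of mfun_Sub (mem_set mh)].
pose Ym := [the {mfun T >-> R} of mfun_Sub (mem_set mY)].
pose hY : {mfun T >-> (R * R)%type} :=
  [the {mfun T >-> (R * R)%type} of mfun_Sub (mem_set (measurable_fun_pair mh mY))].
pose mu1 := distribution P hm.
pose mu2 := distribution P Ym.
pose mu := distribution P hY.
have Emu A B : measurable A -> measurable B -> mu (A `*` B) = (mu1 A * mu2 B)%E.
  move=> mA mB; rewrite /mu /mu1 /mu2 /distribution /pushforward /=.
  have -> : (fun x => (h x, Y x)) @^-1` (A `*` B) = h @^-1` A `&` Y @^-1` B.
    by [].
  by apply: indep => //; rewrite -[X in _ X]setTI; exact: hh.
have mu12 X : measurable X -> (mu1 \x mu2)%E X = mu X.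
  exact: (product_measure_unique Emu).
pose f (z : (R * R)%type) : \bar R := (z.1 * z.2)%:E.
have mf : measurable_fun [set: (R * R)%type] f.
  by apply/measurable_EFinP; apply: measurable_funM; [exact: measurable_fst|exact: measurable_snd].
have absE (Z : {mfun T >-> R}) : P.-integrable setT (EFin \o (Z : T -> R)) ->
   (\int[distribution P Z]_x `|x%:E| < +oo)%E.
  move=> /integrableP[_]; rewrite ge0_integral_distribution//.
  by apply: measurableT_comp => //; exact/measurable_EFinP.
have i1 : mu1.-integrable setT (fun x : R => x%:E).
  by apply/integrableP; split; [exact/measurable_EFinP|exact: absE].
have i2 : mu2.-integrable setT (fun x : R => x%:E).
  by apply/integrableP; split; [exact/measurable_EFinP|exact: absE].
have ifm : (mu1 \x mu2)%E.-integrable setT f.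
  apply/integrable12ltyP => //.
  rewrite (eq_integral (fun x : R => (`|x%:E| * \int[mu2]_y `|y%:E|)%E)); last first.
    move=> x _; rewrite -ge0_integralZl//.
    - by apply: eq_integral => y _; rewrite /f /= normrM.
    - by apply: measurableT_comp => //; exact/measurable_EFinP.
  rewrite ge0_integralZr//; last 2 first.
    by apply: measurableT_comp => //; exact/measurable_EFinP.
    by apply: integral_ge0.
  apply: lte_mul_pinfty; first exact: integral_ge0.
    by rewrite ge0_fin_numE ?integral_ge0//; exact: absE.
  exact: absE.
have eqI g : (\int[mu]_z g z = \int[mu1 \x mu2]_z g z)%E.
  by apply: eq_measure_integral => A mA _; apply: esym; exact: mu12.
have ifmu : mu.-integrable setT f.
  apply/integrableP; split => //.
  rewrite eqI.
  by case/integrableP : ifm.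
have ihY : P.-integrable setT (fun w => (h w * Y w)%:E).
  apply/integrableP; split; first by apply/measurable_EFinP; exact: measurable_funM.
  case/integrableP : ifmu => _; rewrite ge0_integral_distribution//.
  exact: measurableT_comp.
split => //; rewrite /Rintegral.
have -> : (\int[P]_w (h w * Y w)%:E)%E = (\int[mu]_z f z)%E.
  by rewrite integral_distribution.
rewrite eqI -integral12_prod_meas1// /fubini_F /f /=.
rewrite (eq_integral (fun x : R => (x%:E * \int[mu2]_y y%:E)%E)); last first.
  by move=> x _; rewrite -integralZl.
have -> : (\int[mu2]_y y%:E)%E = (\int[P]_w (Y w)%:E)%E by rewrite integral_distribution.
have fY : (\int[P]_w (Y w)%:E)%E \is a fin_num by exact: integrable_fin_num.
have fh : (\int[P]_w (h w)%:E)%E \is a fin_num by exact: integrable_fin_num.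
rewrite -(fineK fY) integralZr//.
have -> : (\int[mu1]_y y%:E)%E = (\int[P]_w (h w)%:E)%E by rewrite integral_distribution.
by rewrite -(fineK fh) -EFinM.
Qed.

End independence.

(** * Independence of Brownian increments from the past *)

Section brownian_independence.
Context {d : measure_display} {T : measurableType d} {R : realType}.
Variable P : probability T R.

(** The intersections of one event per index, with [G] in place of [F i0], form a pi-system
    generating the joint sigma-algebra, so the product formula has to be checked only there. The
    lemma serves once for the increments of one path, with [G] trivial, and once for the family of
    paths, with [G] the past of one of them. *)
Lemma mutually_independent_extend (I : finType) (F : I -> set (set T)) (i0 : I)
    (G : set (set T)) (E : set T) :
  mutually_independent P F ->
  (forall i, F i `<=` measurable) -> (forall i, setI_closed (F i)) ->
  (forall i, F i setT) ->
  G `<=` F i0 -> setI_closed G -> G setT -> F i0 E ->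
  (forall A, G A -> P (A `&` E) = (P A * P E)%E) ->
  forall A, <<s (\bigcup_(j in [set j | j <> i0]) F j) `|` G >> A ->
    P (A `&` E) = (P A * P E)%E.
Proof.
move=> indF Fm FI FT GF GI GT FE GE.
pose ok i := if i == i0 then G else F i.
have okF i : ok i `<=` F i by rewrite /ok; case: eqP => [->|_].
pose C := [set A | exists2 a : I -> set T, (forall i, ok i (a i)) &
  A = \bigcap_(i in [set` [set: I]%SET]) a i].
have okT i : ok i setT by rewrite /ok; case: ifP.
have sC : <<s (\bigcup_(j in [set j | j <> i0]) F j) `|` G >> `<=` <<s C >>.
  apply: smallest_sub; first exact: smallest_sigma_algebra.
  have okC i A : ok i A -> <<s C >> A.
    move=> okA; apply: sub_sigma_algebra.
    exists (fun j => if j == i then A else setT).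
      by move=> j; case: eqP => [->|_].
    apply/seteqP; split=> [x Ax j _|x].
      by case: eqP.
    by move=> /(_ i); rewrite /= inE eqxx; exact.
  move=> A [[j /= ji0 FA]|GA].
    by apply: (okC j); rewrite /ok; case: eqP.
  by apply: (okC i0); rewrite /ok eqxx.
move=> A /sC; apply: pi_system_independent.
- move=> _ [a oka ->]; apply: fin_bigcap_measurable => [|i _]; first exact: finite_finset.
  exact: Fm (okF _ _ (oka i)).

- move=> _ _ [a oka ->] [b okb ->].
  exists (fun i => a i `&` b i); last by rewrite bigcapI.
  move=> i; move: (oka i) (okb i); rewrite /ok; case: ifP => _.
    exact: GI.
  exact: FI.
- exact: Fm FE.
- move=> _ [a oka ->].
  rewrite (indF _ a); last by move=> i _; exact: okF.
  (* As [E] lies in [F i0], it can be absorbed into the event of index [i0]; independence of the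
     family then applies both with and without [E]. *)
  pose b i := if i == i0 then a i `&` E else a i.
  have -> : \bigcap_(i in [set` [set: I]%SET]) a i `&` E =
            \bigcap_(i in [set` [set: I]%SET]) b i.
    apply/seteqP; split=> [x [ax Ex] i iI|x bx].
      by rewrite /b; case: eqP => [_|_]; [split => //|]; exact: ax.
    split.
      move=> i iI; move: (bx i iI); rewrite /b; case: eqP => // _ [].
      by [].
    by move: (bx i0); rewrite /b eqxx /= inE => /(_ erefl)[].
  rewrite (indF _ b); last first.
    move=> i _; rewrite /b; case: eqP => [->|_]; last exact: okF.
    by apply: FI => //; apply: okF.
  rewrite (bigD1 i0)//= (bigD1 i0 (F := fun i => P (a i)))//=.
  rewrite /b eqxx GE; last by move: (oka i0); rewrite /ok eqxx.
  rewrite -muleA [(P E * _)%E]muleC muleA; congr (_ * _ * _)%E.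
  by apply: eq_bigr => i /andP[_ /negbTE ->].
Qed.

(** Conditions at finitely many times, in any order and with repetitions, so that stability under
    intersection is a plain induction; the times are sorted only where independent increments are
    used. *)
Inductive past_cylinder (X : R -> T -> R) (s : R) : set T -> Prop :=
| past_cylinderT : past_cylinder X s setT
| past_cylinderI u U A : 0 <= u <= s -> measurable U -> past_cylinder X s A ->
    past_cylinder X s (X u @^-1` U `&` A).

Lemma past_cylinder_setI X s : setI_closed (past_cylinder X s).
Proof.
move=> A A' cA cA'; elim: cA => [|u U A0 us mU _ IH]; first by rewrite setTI.
by rewrite -setIA; exact: past_cylinderI.
Qed.

(** The quantifier over [C] allows the conditioning family to be chosen after the finite list of
    times is known. *)
Lemma past_cylinder_times X s A : past_cylinder X s A ->
  exists2 l : seq R, all (fun u => 0 <= u <= s) l &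
  forall C, (forall u, u \in l -> adapted C (X u)) -> <<s C >> A.
Proof.
elim=> [|u U A0 us mU _ [l ls lA]].
  by exists [::] => // C _; exact: (@measurableT _ (g_sigma_algebraType C)).
exists (u :: l) => [/=|C uC]; first by rewrite us.
apply: (@measurableI _ (g_sigma_algebraType C)).
  by rewrite -[X in measurable X]setTI; apply: uC => //; rewrite mem_head.
by apply: lA => v vl; apply: uC; rewrite inE vl orbT.
Qed.

Lemma preimage_set_system_setI (X : T -> R) :
  setI_closed (preimage_set_system setT X measurable).
Proof.
move=> _ _ [U mU <-] [V mV <-]; exists (U `&` V); first exact: measurableI.
by rewrite preimage_setI !setTI.
Qed.

Lemma preimage_set_systemT (X : T -> R) :
  preimage_set_system setT X measurable setT.
Proof. by exists setT => //; rewrite preimage_setT setTI. Qed.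

(** Since the path starts at 0, its value at a grid time is the sum of the increments before it. The
    values at the times in [l] are thus functions of the increments up to [s], which are independent
    of the next one. *)
Lemma brownian_increment_past_times (B : R -> T -> R) (s t : R) (l : seq R) :
  standard_brownian_motion P B -> 0 <= s -> s < t ->
  all (fun u => 0 <= u <= s) l ->
  exists2 C : set (set T), C `<=` measurable &
    (forall u, u \in l -> adapted C (B u)) /\
    independent_of P C (fun w => B t w - B s w).
Proof.
move=> BM s0 st ls; set m := (size l).+1.
(* Index [m] of the grid holds [s], and the default value of [nth] is [t]: the sequence [tt] is
   nondecreasing on all of [nat], and its increment of index [m] is the one from [s] to [t]. *)
pose ts := 0 :: rcons (sort <=%R l) s.
have sts : size ts = m.+1 by rewrite /= size_rcons size_sort.
pose tt j := nth t ts j.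
have ttm : tt m = s by rewrite /tt /ts /m /= nth_rcons size_sort ltnn eqxx.
have ttS j : (m < j)%N -> tt j = t by move=> mj; rewrite /tt nth_default// sts.
have ls' u : u \in sort <=%R l -> 0 <= u <= s by rewrite mem_sort => /(allP ls).
have ts_le u : u \in ts -> 0 <= u <= s.
  rewrite inE => /predU1P[->|]; first by rewrite lexx.
  by rewrite mem_rcons inE => /predU1P[->|/ls'//]; rewrite s0 lexx.
have sorted_ts : sorted <=%R ts.
  rewrite sorted_pairwise; last exact: le_trans.
  rewrite /ts /= pairwise_rcons -sorted_pairwise; last exact: le_trans.
  rewrite sort_le_sorted andbT; apply/andP; split.
    apply/allP => u uts; have := ts_le u; rewrite inE uts orbT => /(_ erefl).
    by case/andP.
  by apply/allP => u /ls' /andP[].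
have nd : nondecreasing_seq tt.
  apply/nondecreasing_seqP => j.
  have [jm|mj] := ltnP j m.
    by move/(sortedP t) : sorted_ts; apply; rewrite sts.
  rewrite (ttS j.+1)//; have [ej|nj] := eqVneq j m.
    by rewrite ej ttm ltW.
  by rewrite ttS// ltn_neqAle eq_sym nj.
have t0 : 0 <= tt 0%N by rewrite /tt.
have B_mf j : measurable_fun setT (B (tt j)).
  by apply: (bm_measurable BM); rewrite (le_trans t0)// nd.
pose dB (j : 'I_m.+1) w := B (tt j.+1) w - B (tt j) w.
pose F (j : 'I_m.+1) := preimage_set_system setT (dB j) measurable.
have Fm j : F j `<=` measurable.
  by move=> _ [U mU <-]; apply: (measurable_funB (B_mf _) (B_mf _)).
have indF : mutually_independent P F by exact: (bm_independent_increments BM).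
(* All increments except the last one; the summand [[set setT]] plays the part of [G] in
   [mutually_independent_extend]. *)
pose C := (\bigcup_(j in [set j | j <> ord_max]) F j) `|` [set setT].
exists C; first by move=> A [[j _]|->] //; exact: Fm.
split.
  have adB j : (j <= m)%N -> adapted C (B (tt j)).
    elim: j => [_|j IH jm].
      have -> : B (tt 0%N) = cst 0 by apply/funext => w; rewrite /tt /= (bm_start BM).
      exact: measurable_cst.
    have -> : B (tt j.+1) = (dB (Ordinal (ltnW (jm : j.+1 < m.+1)%N)) \+ B (tt j))%R.
      by apply/funext => w /=; rewrite /dB /= subrK.
    apply: measurable_funD; last by apply: IH; exact: ltnW.
    move=> _ U mU; apply: sub_sigma_algebra; left.
    exists (Ordinal (ltnW (jm : j.+1 < m.+1)%N)); last by exists U.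
    by move=> /(congr1 val) /= ej; rewrite ej ltnn in jm.
  move=> u ul.
  have uts : u \in ts by rewrite inE mem_rcons inE mem_sort ul !orbT.
  rewrite -(nth_index t uts); apply: adB.
  by rewrite -ltnS -sts index_mem.
move=> A U CA mU; apply: (mutually_independent_extend indF Fm) CA => //.
- by move=> j; exact: preimage_set_system_setI.
- by move=> j; exact: preimage_set_systemT.
- by move=> _ ->; exact: preimage_set_systemT.
- by move=> _ _ -> ->; rewrite setTI.
- exists U => //; rewrite /dB /= ttm ttS//.
  by rewrite setTI.
- by move=> _ ->; rewrite setTI probability_setT mul1e.
Qed.

Lemma brownian_increment_past (B : R -> T -> R) (s t : R) :
  standard_brownian_motion P B -> 0 <= s -> s < t ->
  forall A U, past_cylinder B s A -> measurable U ->
    let E := (fun w => B t w - B s w) @^-1` U in P (A `&` E) = (P A * P E)%E.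
Proof.
move=> BM s0 st A U /past_cylinder_times[l ls lA] mU E.
have [C Cm [adC indC]] := brownian_increment_past_times BM s0 st ls.
by apply: indC => //; exact: lA.
Qed.

(* Adjoining the whole paths of the other coordinates lets an increment of another
   coordinate be absorbed into the conditioning, which kills the cross terms of the
   squared increment of a weighted sum. *)
Definition past_and_others {n : nat} (B : 'I_n -> R -> T -> R) (i : 'I_n) (s : R) :=
  (\bigcup_(j in [set j | j <> i]) generated_events `[0, +oo[ (B j)) `|`
  past_cylinder (B i) s.

(** The extension lemma is applied to the sigma-algebras of whole paths: the increment belongs to
    that of path [i], and it is independent of the cylinders of that path up to [s]. *)
Lemma increment_independent_of_past n (B : 'I_n -> R -> T -> R) i (s t : R) :
  (forall i, standard_brownian_motion P (B i)) -> independent_processes P B ->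
  0 <= s -> s < t ->
  past_and_others B i s `<=` measurable /\
  independent_of P (past_and_others B i s) (fun w => B i t w - B i s w).
Proof.
move=> BM indB s0 st.
have Bm j u : 0 <= u -> measurable_fun setT (B j u) by exact: bm_measurable.
pose C j := \bigcup_(k in `[0%R, +oo[%classic) preimage_set_system setT (B j k) measurable.
have Cm j : C j `<=` measurable.
  move=> A [u u0 [U mU <-]]; apply: Bm => //.
  by move: u0; rewrite /= in_itv/= andbT.
have Gm j : generated_events `[0, +oo[ (B j) `<=` measurable.
  exact: (sigma_sub_measurable (Cm j)).
have adC j u : 0 <= u -> adapted (C j) (B j u).
  move=> u0 _ U mU; apply: sub_sigma_algebra; exists u; last by exists U.
  by rewrite /= in_itv/= u0.
have pastG j : past_cylinder (B j) s `<=` generated_events `[0, +oo[ (B j).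
  move=> A /past_cylinder_times[l ls lA]; apply: lA => u ul; apply: adC.
  by have /andP[] := allP ls _ ul.
split; first by move=> A [[j _]|/pastG]; exact: Gm.
move=> A U CA mU; apply: (mutually_independent_extend indB) CA => //.
- by move=> j; apply: (@measurableI _ (g_sigma_algebraType (C j))).
- by move=> j; apply: (@measurableT _ (g_sigma_algebraType (C j))).
- exact: past_cylinder_setI.
- exact: past_cylinderT.
- have : adapted (C i) (fun w => B i t w - B i s w).
    by apply: measurable_funB; apply: adC => //; rewrite (le_trans s0)// ltW.
  by move=> /(_ measurableT U mU); rewrite setTI.
- by move=> A0 cA0; exact: brownian_increment_past.
Qed.

Lemma adapted_others n (B : 'I_n -> R -> T -> R) i j s u :
  j <> i -> 0 <= u -> adapted (past_and_others B i s) (B j u).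
Proof.
move=> ji u0 _ U mU; apply: sub_sigma_algebra; left; exists j => //.
apply: sub_sigma_algebra; exists u; last by exists U.
by rewrite /= in_itv/= u0.
Qed.

Lemma adapted_past n (B : 'I_n -> R -> T -> R) i s u :
  0 <= u <= s -> adapted (past_and_others B i s) (B i u).
Proof.
move=> us _ U mU; apply: sub_sigma_algebra; right.
rewrite setTI -[X in _ X]setIT; apply: past_cylinderI => //.
exact: past_cylinderT.
Qed.

End brownian_independence.

(** * Mean and variance of the centred normal law *)

Section normal_moments.
Context {R : realType}.
Local Notation mu := (@lebesgue_measure R).

(** Change of variables holds with the Radon-Nikodym derivative, which equals [normal_pdf] almost
    everywhere because both have the same integral over every measurable set. *)
Lemma ge0_integral_normal_prob (m s : R) (f : R -> \bar R) :
  (forall x, 0 <= f x)%E -> measurable_fun setT f ->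
  (\int[normal_prob m s]_x f x = \int[mu]_x (f x * (normal_pdf m s x)%:E))%E.
Proof.
move=> f0 mf.
have dom := normal_prob_dominates m s.
rewrite -(Radon_Nikodym_SigmaFinite.change_of_variables dom)//=.
have mpdf : measurable_fun setT (EFin \o normal_pdf m s).
  by apply/measurable_EFinP; exact: measurable_normal_pdf.
have iRN := Radon_Nikodym_SigmaFinite.f_integrable dom.
apply: ae_eq_integral => //.
- by apply: emeasurable_funM => //; exact: measurable_int iRN.
- exact: emeasurable_funM.
- apply: ae_eqe_mul2l; apply: integral_ae_eq => // E _ mE.
  by rewrite -Radon_Nikodym_SigmaFinite.f_integral.
Qed.

Lemma integral_normal_prob (m s : R) (f : R -> R) :
  measurable_fun setT f ->
  (\int[normal_prob m s]_x (f x)%:E = \int[mu]_x (f x * normal_pdf m s x)%:E)%E.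
Proof.
move=> mf.
have mfE : measurable_fun setT (EFin \o f) by exact/measurable_EFinP.
rewrite integralE [RHS]integralE; congr (_ - _)%E.
  rewrite ge0_integral_normal_prob//; last exact: measurable_funepos.
  apply: eq_integral => x _.
  by rewrite !funeposE EFinM maxeMl ?lee_fin ?normal_pdf_ge0// mul0e.
rewrite ge0_integral_normal_prob//; last exact: measurable_funeneg.
apply: eq_integral => x _.
by rewrite !funenegE EFinM -muleN maxeMl ?lee_fin ?normal_pdf_ge0// mul0e muleN mulNe.
Qed.

(** Both moments come from antiderivatives: with [p] the density, [x p] and [(x^2 - s^2) p] are the
    derivatives of [- s^2 p] and [- s^2 x p]. The fundamental theorem on growing symmetric
    intervals, with domination by [|f|], gives the value 0. *)
Lemma integral_derivative0 (f F : R -> R) :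
  continuous f -> mu.-integrable setT (EFin \o f) ->
  (forall x : R, is_derive x 1 F (f x)) ->
  (fun n : nat => F n%:R - F (- n%:R)) @ \oo --> (0 : R) ->
  (\int[mu]_x (f x)%:E = 0)%E.
Proof.
move=> cf intf dF F0.
pose D n := `[(- n.+1%:R : R), n.+1%:R]%classic.
pose f_ n := (fun x => (f x)%:E) \_ (D n).
have mf := measurable_int mu intf.
have [] := @dominated_convergence _ _ _ mu setT measurableT f_
  (fun x => (f x)%:E) (fun x => `|f x|%:E).
- move=> n; apply/(measurable_restrictT _ (measurable_itv _)).
  exact: measurable_funS mf.
- exact: mf.
- apply: aeW => x _; apply: cvg_near_cst; near=> n.
  rewrite /f_ patchE mem_set// /D /= in_itv/= -ler_norml.
  rewrite (@le_trans _ _ n%:R)//; last by rewrite ler_nat.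
  by near: n; exact: nbhs_infty_ger.
- exact: integrable_norm.
- apply: aeW => x n _; rewrite /f_ patchE; case: ifPn => _ //.
  by rewrite abse0 lee_fin.
move=> _ _ cvgI; apply/esym; apply: cvg_unique cvgI => //.
have -> : (fun n => \int[mu]_x f_ n x)%E = (fun n => (F n.+1%:R - F (- n.+1%:R))%:E).
  apply/funext => n; rewrite /f_ -integral_mkcond.
  rewrite (@continuous_FTC2 _ f F) ?EFinB//.
  - by rewrite gtrN.
  - exact: continuous_subspaceT.
  - have cF : continuous F by move=> x; apply/differentiable_continuous/derivable1_diffP; exact: (@ex_derive _ _ _ _ _ _ _ (dF x)).
    split.
    + by move=> x _; exact: (@ex_derive _ _ _ _ _ _ _ (dF x)).
    + by apply: cvg_at_right_filter; exact: cF.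
    + by apply: cvg_at_left_filter; exact: cF.
  - by move=> x _; rewrite derive1E; exact: (@derive_val _ _ _ _ _ _ _ (dF x)).
by apply: cvg_EFin; [near=> n|]; rewrite // (@cvg_shiftS _ (fun n : nat => F n%:R - F (- n%:R))).
Unshelve. all: by end_near. Qed.

Lemma normal_pdf0E (s : R) : s != 0 ->
  normal_pdf 0 s = fun x => normal_peak s * expR (- (x ^+ 2) / (s ^+ 2 *+ 2)).
Proof.
move=> s0; rewrite normal_pdfE//; apply/funext => x.
by rewrite /normal_fun subr0.
Qed.

Lemma is_derive_normal_pdf (s x : R) : s != 0 ->
  is_derive x 1 (normal_pdf 0 s) (- (x / s ^+ 2) * normal_pdf 0 s x).
Proof.
move=> s0; rewrite normal_pdf0E//.
apply: is_derive_eq.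
by rewrite /GRing.scale /=; field.
Qed.

(** With [y = x^2 / (4 s^2)] the exponential is [exp (- y) * exp (- y)]. One factor absorbs
    [x^2 = 4 s^2 y] through [y exp (- y) <= 1], the other is a normal density of variance [2 s^2] up
    to its peak; this explains the constant. *)
Lemma sqr_normal_pdf_le (s x : R) : s != 0 ->
  x ^+ 2 * normal_pdf 0 s x <=
  (4 * s ^+ 2 * normal_peak s / normal_peak (s * Num.sqrt 2)) *
    normal_pdf 0 (s * Num.sqrt 2) x.
Proof.
move=> s0; have s20 : s * Num.sqrt 2 != 0.
  by rewrite mulf_neq0// gt_eqF// sqrtr_gt0.
rewrite !normal_pdf0E//.
have ss : 0 < s ^+ 2 by rewrite exprn_even_gt0.
rewrite exprMn sqr_sqrtr//.
set k := normal_peak _; set k' := normal_peak (s * _).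
have k'0 : 0 < k' by exact: normal_peak_gt0.
have -> : 4 * s ^+ 2 * k / k' * (k' * expR (- x ^+ 2 / (s ^+ 2 * 2 *+ 2))) =
  k * (4 * s ^+ 2 * expR (- x ^+ 2 / (s ^+ 2 * 2 *+ 2))).
  by field; rewrite gt_eqF.
rewrite mulrCA ler_pM2l ?normal_peak_gt0//.
set y := x ^+ 2 / (s ^+ 2 * 2 *+ 2).
have -> : - x ^+ 2 / (s ^+ 2 *+ 2) = - y + - y by rewrite /y; field.
have -> : - x ^+ 2 / (s ^+ 2 * 2 *+ 2) = - y by rewrite /y; field.
rewrite expRD mulrA ler_pM2r ?expR_gt0//.
have -> : x ^+ 2 = 4 * s ^+ 2 * y by rewrite /y; field.
rewrite -(mulrA _ y). apply: ler_piMr; first by rewrite mulr_ge0 ?sqr_ge0.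
rewrite expRN ler_pdivrMr ?expR_gt0// mul1r.
by rewrite (le_trans _ (expR_ge1Dx _))// lerDr.
Qed.

Lemma integrable_sqr_normal_pdf (s : R) : s != 0 ->
  mu.-integrable setT (EFin \o (fun x => x ^+ 2 * normal_pdf 0 s x)).
Proof.
move=> s0; set C := 4 * s ^+ 2 * normal_peak s / normal_peak (s * Num.sqrt 2).
apply: (le_integrable measurableT _ _ (integrableZl measurableT C
  (integrable_normal_pdf 0 (s * Num.sqrt 2)))).
  apply/measurable_EFinP; apply: measurable_funM; last exact: measurable_normal_pdf.
  exact: exprn_measurable.
move=> x _; rewrite -EFinM !abse_EFin lee_fin.
rewrite !ger0_norm; last 2 first.
- rewrite mulr_ge0 ?normal_pdf_ge0//.
  by rewrite /C divr_ge0 ?normal_peak_ge0// mulr_ge0 ?normal_peak_ge0// mulr_ge0 ?sqr_ge0.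
- by rewrite mulr_ge0 ?normal_pdf_ge0 ?sqr_ge0.
exact: sqr_normal_pdf_le.
Qed.

Lemma integrable_id_normal_pdf (s : R) : s != 0 ->
  mu.-integrable setT (EFin \o (fun x => x * normal_pdf 0 s x)).
Proof.
move=> s0; apply: (le_integrable measurableT _ _ (integrableD measurableT
  (integrable_normal_pdf 0 s) (integrable_sqr_normal_pdf s0))).
  by apply/measurable_EFinP; apply: measurable_funM => //; exact: measurable_normal_pdf.
move=> x _; change (`|(x * normal_pdf 0 s x)%:E| <= `|(normal_pdf 0 s x + x ^+ 2 * normal_pdf 0 s x)%:E|)%E.
rewrite !abse_EFin lee_fin normrM (ger0_norm (normal_pdf_ge0 _ _ _)).
have p0 := normal_pdf_ge0 0 s x.
rewrite [leRHS]ger0_norm; last by rewrite addr_ge0// mulr_ge0// sqr_ge0.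
rewrite -{2}[normal_pdf 0 s x]mul1r -mulrDl ler_wpM2r//.
rewrite -[x ^+ 2]real_normK ?num_real//.
by have := sqr_ge0 (`|x| - 1); have := normr_ge0 x; nra.
Qed.

Lemma normal_pdf_cvg0 (s : R) : s != 0 ->
  (fun n : nat => n%:R * normal_pdf 0 s n%:R) @ \oo --> (0 : R).
Proof.
move=> s0; have s20 : s * Num.sqrt 2 != 0.
  by rewrite mulf_neq0// gt_eqF// sqrtr_gt0.
set C := 4 * s ^+ 2 * normal_peak s / normal_peak (s * Num.sqrt 2) *
  normal_peak (s * Num.sqrt 2).
apply: (@squeeze_cvgr _ _ _ _ (cst 0) (fun n : nat => C * n%:R^-1)).
- apply: nearW => n /=; rewrite mulr_ge0 ?normal_pdf_ge0//=.
  have [->|n0] := eqVneq n 0%N; first by rewrite mul0r invr0 mulr0.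
  rewrite ler_pdivlMr ?ltr0n ?lt0n// mulrAC -expr2.
  rewrite (le_trans (sqr_normal_pdf_le _ s0))// ler_wpM2l ?normal_pdf_ub//.
  by rewrite divr_ge0 ?normal_peak_ge0// mulr_ge0 ?normal_peak_ge0// mulr_ge0 ?sqr_ge0.
- exact: cvg_cst.
- rewrite -(mulr0 C); apply: cvgM; first exact: cvg_cst.
  by rewrite -(@cvg_shiftS _ (fun n : nat => n%:R^-1 : R)); exact: cvg_harmonic.
Qed.

Lemma normal_pdf_opp (s x : R) : s != 0 -> normal_pdf 0 s (- x) = normal_pdf 0 s x.
Proof. by move=> s0; rewrite normal_pdf0E// sqrrN. Qed.

Lemma normal_mean (s : R) : s != 0 -> (\int[normal_prob 0 s]_x x%:E = 0)%E.
Proof.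
move=> s0; rewrite (integral_normal_prob _ _ (f := fun x : R => x))//.
apply: (@integral_derivative0 _ (fun x => - s ^+ 2 * normal_pdf 0 s x)).
- by move=> x; apply: cvgM; [exact: cvg_id|exact: continuous_normal_pdf].
- exact: integrable_id_normal_pdf.
- move=> x; have dp := is_derive_normal_pdf x s0.
  by apply: is_derive_eq; rewrite /GRing.scale /=; field.
- by under eq_fun do rewrite normal_pdf_opp// subrr; exact: cvg_cst.
Qed.

Lemma normal_second_moment (s : R) : s != 0 ->
  (\int[normal_prob 0 s]_x (x ^+ 2)%:E = (s ^+ 2)%:E)%E.
Proof.
move=> s0; rewrite (integral_normal_prob _ _ (f := fun x : R => x ^+ 2))//.
  have ip := integrable_normal_pdf 0 s.
  have ips : mu.-integrable setT (fun x => (s ^+ 2)%:E * (normal_pdf 0 s x)%:E)%E.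
    exact: integrableZl.
  have := @integral_derivative0 (fun x => x ^+ 2 * normal_pdf 0 s x - s ^+ 2 * normal_pdf 0 s x)
    (fun x => - s ^+ 2 * (x * normal_pdf 0 s x)).
  under eq_integral do rewrite EFinB.
  rewrite integralB_EFin//; last exact: integrable_sqr_normal_pdf.
  under [X in (_ - X)%E]eq_integral do rewrite EFinM.
  rewrite integralZl// integral_normal_pdf mule1 => H.
  rewrite -[LHS](@subeK _ _ (s ^+ 2)%:E)//.
  suff -> : (\int[mu]_x (x ^+ 2 * normal_pdf 0 s x)%:E - (s ^+ 2)%:E = 0)%E by rewrite add0e.
  apply: H.
  - move=> x; apply: cvgB; apply: cvgM; first exact: exprn_continuous.
    + exact: continuous_normal_pdf.
    + exact: cvg_cst.
    + exact: continuous_normal_pdf.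
  - by apply: (integrableB measurableT (integrable_sqr_normal_pdf s0) ips).
  - move=> x; have dp := is_derive_normal_pdf x s0.
    by apply: is_derive_eq; rewrite /GRing.scale /=; field.
  - rewrite (_ : (fun _ => _) = fun n : nat => (- s ^+ 2 *+ 2) * (n%:R * normal_pdf 0 s n%:R)).
      have := @cvgMl_tmp R _ _ _ _ (- s ^+ 2 *+ 2) 0 (normal_pdf_cvg0 s0).
      by rewrite mulr0; apply.
    by apply/funext => n; rewrite normal_pdf_opp//; ring.
Qed.

End normal_moments.

(** * Integrable and square integrable real functions *)

Section real_integrals.
Context {d : measure_display} {T : measurableType d} {R : realType}.
Variable mu : {measure set T -> \bar R}.
Implicit Types f g : T -> R.

Definition integrable_fun (f : T -> R) := mu.-integrable setT (EFin \o f).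

Lemma eq_integrable_fun f g : f =1 g -> integrable_fun f -> integrable_fun g.
Proof. by move=> /funext ->. Qed.

Lemma integrable_funD f g : integrable_fun f -> integrable_fun g ->
  integrable_fun (fun w => f w + g w).
Proof. by move=> mf mg; exact: (integrableD measurableT mf mg). Qed.

Lemma integrable_funB f g : integrable_fun f -> integrable_fun g ->
  integrable_fun (fun w => f w - g w).
Proof. by move=> mf mg; exact: (integrableB measurableT mf mg). Qed.

Lemma integrable_funZ k f : integrable_fun f -> integrable_fun (fun w => k * f w).
Proof. by move=> mf; exact: (integrableZl measurableT k mf). Qed.

Lemma integrable_fun_measurable f : integrable_fun f -> measurable_fun setT f.
Proof. by move=> /(measurable_int mu)/measurable_EFinP. Qed.

Lemma integrable_fun_le f g : measurable_fun setT f ->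
  (forall w, `|f w| <= g w) -> integrable_fun g -> integrable_fun f.
Proof.
move=> mf fg ig; apply: (le_integrable measurableT _ _ ig).
  exact/measurable_EFinP.
move=> w _; rewrite /= lee_fin (le_trans (fg w))// ler_norm//.
Qed.

Lemma integrable_fun_sum (I : Type) (s : seq I) (f : I -> T -> R) :
  (forall i, integrable_fun (f i)) ->
  integrable_fun (fun w => \sum_(i <- s) f i w) /\
  \int[mu]_w (\sum_(i <- s) f i w) = \sum_(i <- s) \int[mu]_w f i w.
Proof.
move=> mf; elim: s => [|i s [is_ IH]].
  split.
    apply: (@eq_integrable_fun (cst 0)); last exact: integrable0.
    by move=> w; rewrite big_nil.
  under eq_Rintegral do rewrite big_nil.
  by rewrite big_nil /Rintegral integral0.
split.
  apply: (eq_integrable_fun _ (integrable_funD (mf i) is_)) => w.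
  by rewrite big_cons.
rewrite big_cons -IH -(RintegralD measurableT (mf i) is_).
by apply: eq_Rintegral => w _; rewrite big_cons.
Qed.

Definition square_integrable (f : T -> R) :=
  measurable_fun setT f /\ integrable_fun (fun w => f w ^+ 2).

Lemma square_integrableM f g : square_integrable f -> square_integrable g ->
  integrable_fun (fun w => f w * g w).
Proof.
move=> [mf f2] [mg g2]; apply: integrable_fun_le (integrable_funD f2 g2).
  exact: measurable_funM.
move=> w; rewrite normrM -[f w ^+ 2]real_normK ?num_real// -[g w ^+ 2]real_normK ?num_real//.
have := sqr_ge0 (`|f w| - `|g w|); have := normr_ge0 (f w).
by have := normr_ge0 (g w); nra.
Qed.

Lemma square_integrableD f g : square_integrable f -> square_integrable g ->
  square_integrable (fun w => f w + g w).
Proof.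
move=> sf sg; split; first by apply: measurable_funD; [case: sf|case: sg].
have fg := integrable_funZ 2 (square_integrableM sf sg).
by apply: (eq_integrable_fun _
  (integrable_funD sf.2 (integrable_funD fg sg.2))) => w; ring.
Qed.

End real_integrals.

(** * Moments of a Brownian increment *)

Section brownian_moments.
Context {d : measure_display} {T : measurableType d} {R : realType}.
Variable P : probability T R.
Implicit Types f g : T -> R.

Lemma integrable_fun_cst (k : R) : integrable_fun P (fun => k).
Proof. exact: finite_measure_integrable_cst. Qed.

Lemma square_integrable_cst (k : R) : square_integrable P (fun => k).
Proof. by split => //; exact: integrable_fun_cst. Qed.

Lemma square_integrable_integrable f : square_integrable P f -> integrable_fun P f.
Proof.
move=> sf; have := square_integrableM sf (square_integrable_cst 1).
by under [X in integrable_fun _ X -> _]eq_fun do rewrite mulr1.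
Qed.

Lemma brownian_increment_moments (B : R -> T -> R) (s t : R) :
  standard_brownian_motion P B -> 0 <= s -> s < t ->
  [/\ square_integrable P (fun w => B t w - B s w),
    \int[P]_w (B t w - B s w) = 0 &
    \int[P]_w ((B t w - B s w) ^+ 2) = t - s].
Proof.
move=> BM s0 st.
have t0 : 0 <= t by rewrite (le_trans s0)// ltW.
have mY : measurable_fun setT (fun w => B t w - B s w).
  by apply: measurable_funB; exact: (bm_measurable BM).
have mY' : @measurable_fun _ _ T (measurableTypeR R) setT (fun w => B t w - B s w) := mY.
pose Y : {mfun T >-> measurableTypeR R} :=
  @mfun_Sub _ _ T (measurableTypeR R) _ (mem_set mY').
pose N : probability _ R := normal_prob 0 (Num.sqrt (t - s)).
have lawE (f : R -> \bar R) :
    (\int[distribution P Y]_x f x = \int[N]_x f x)%E.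
  apply: (eq_measure_integral N) => A mA _.
  exact: (bm_normal_increments BM s0 st mA).
have sd0 : Num.sqrt (t - s) != 0 by rewrite gt_eqF// sqrtr_gt0 subr_gt0.
have m2 : (\int[P]_w ((B t w - B s w) ^+ 2)%:E = (t - s)%:E)%E.
  rewrite -[in RHS](@sqr_sqrtr _ (t - s)) ?subr_ge0 ?ltW// -(normal_second_moment sd0).
  rewrite -lawE ge0_integral_distribution//.
  - by apply/measurable_EFinP; exact: exprn_measurable.
  - by move=> y; rewrite lee_fin sqr_ge0.
have sqY : square_integrable P (fun w => B t w - B s w).
  split => //; apply/integrableP; split.
    by apply/measurable_EFinP; exact: measurable_funX.
  under eq_integral do rewrite /= ger0_norm ?sqr_ge0//.
  by rewrite m2 ltry.
split => //.
- rewrite /Rintegral -[RHS]/(fine 0%E) -(normal_mean sd0) -lawE integral_distribution//.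
  exact: square_integrable_integrable.
- by rewrite /Rintegral m2.
Qed.

End brownian_moments.

(** * Increments of a weighted sum tested against the past *)

Section weighted_sum.
Context {d : measure_display} {T : measurableType d} {R : realType}.
Variable P : probability T R.
Variables (n : nat) (B : 'I_n -> R -> T -> R).
Hypothesis BM : forall i, standard_brownian_motion P (B i).
Hypothesis indB : independent_processes P B.

(** Asking for measurability with respect to every [past_and_others B i s] at once covers all
    functions of the coordinates up to time [s], and makes [h] independent of the next increment of
    each single coordinate. *)
Definition past_measurable (s : R) (h : T -> R) : Prop :=
  forall i, adapted (past_and_others B i s) h.

Definition weighted (b : 'I_n -> R) (t : R) (w : T) : R := \sum_(i < n) b i * B i t w.

Lemma adapted_sub (C C' : set (set T)) (h : T -> R) :
  <<s C >> `<=` <<s C' >> -> adapted C h -> adapted C' h.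
Proof. by move=> CC' hh _ U mU; apply: CC'; exact: hh. Qed.

Lemma past_measurable_brownian s u j : 0 <= u <= s -> past_measurable s (B j u).
Proof.
move=> us i; have [->|/eqP ji] := eqVneq j i; first exact: adapted_past.
by apply: adapted_others => //; case/andP: us.
Qed.

Lemma past_measurable_cst s k : past_measurable s (fun => k).
Proof. by move=> i; exact: measurable_cst. Qed.

Lemma past_measurableD s h g : past_measurable s h -> past_measurable s g ->
  past_measurable s (fun w => h w + g w).
Proof. by move=> mh mg i; exact: measurable_funD (mh i) (mg i). Qed.

Lemma past_measurableM s h g : past_measurable s h -> past_measurable s g ->
  past_measurable s (fun w => h w * g w).
Proof. by move=> mh mg i; exact: measurable_funM (mh i) (mg i). Qed.

Lemma past_measurable_comp s h (f : R -> R) : measurable_fun setT f ->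
  past_measurable s h -> past_measurable s (fun w => f (h w)).
Proof. by move=> mf mh i; exact: measurableT_comp mf (mh i). Qed.

Lemma past_measurable_sum s (I : Type) (r : seq I) (h : I -> T -> R) :
  (forall i, past_measurable s (h i)) ->
  past_measurable s (fun w => \sum_(i <- r) h i w).
Proof.
move=> mh; elim: r => [|i r IH].
  by under [X in past_measurable _ X]eq_fun do rewrite big_nil; exact: past_measurable_cst.
under [X in past_measurable _ X]eq_fun do rewrite big_cons.
exact: past_measurableD.
Qed.

Lemma past_measurable_weighted s u b : 0 <= u <= s -> past_measurable s (weighted b u).
Proof.
move=> us; apply: past_measurable_sum => i; apply: past_measurableM.
  exact: past_measurable_cst.
exact: past_measurable_brownian.
Qed.

Lemma past_measurable_max s h g : past_measurable s h -> past_measurable s g ->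
  past_measurable s (fun w => Num.max (h w) (g w)).
Proof. by move=> mh mg i; exact: measurable_maxr (mh i) (mg i). Qed.

Lemma past_measurable_indic s (A : set T) :
  (forall i, <<s past_and_others B i s >> A) -> past_measurable s (\1_A).
Proof. by move=> sA i; apply: measurable_indic; exact: sA. Qed.

Lemma past_measurable_le s u h : s <= u -> past_measurable s h -> past_measurable u h.
Proof.
move=> su mh i; apply: adapted_sub (mh i).
apply: sub_smallest2r; first exact: smallest_sigma_algebra.
apply: setUS => A; elim=> [|v U A0 /andP[v0 vs] mU _ IH]; first exact: past_cylinderT.
by apply: past_cylinderI => //; rewrite v0 (le_trans vs).
Qed.

Lemma natural_filtration_past (D sigma : 'I_n -> R) s A i :
  natural_filtration (demand D sigma B) s A -> <<s past_and_others B i s >> A.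
Proof.
apply: (smallest_sub (smallest_sigma_algebra _ _)) => X [[j u] /= us [U mU <-]].
have /(_ i measurableT U mU) : past_measurable s (demand D sigma B j u).
  apply: past_measurableD; first exact: past_measurable_cst.
  apply: past_measurableM; first exact: past_measurable_cst.
  exact: past_measurable_brownian.
by [].
Qed.

Lemma past_increment s t h : 0 <= s -> s < t ->
  past_measurable s h -> integrable_fun P h ->
  forall i, [/\ integrable_fun P (fun w => h w * (B i t w - B i s w)),
    \int[P]_w (h w * (B i t w - B i s w)) = 0,
    integrable_fun P (fun w => h w * (B i t w - B i s w) ^+ 2) &
    \int[P]_w (h w * (B i t w - B i s w) ^+ 2) = (t - s) * \int[P]_w h w].
Proof.
move=> s0 st mh ih i.
have [Cm ind] := increment_independent_of_past i BM indB s0 st.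
have [sY mean var] := brownian_increment_moments (BM i) s0 st.
have [iY EY] := independent_product Cm (mh i) sY.1 ind ih (square_integrable_integrable sY).
have ind2 : independent_of P (past_and_others B i s)
    (fun w => (B i t w - B i s w) ^+ 2).
  move=> A U sA mU; apply: (ind A ((fun x => x ^+ 2) @^-1` U) sA).
  by rewrite -[X in measurable X]setTI; apply: exprn_measurable.
have [iY2 EY2] := independent_product Cm (mh i) (measurable_funX 2 sY.1) ind2 ih sY.2.
by split => //; [rewrite EY mean mulr0|rewrite EY2 var mulrC].
Qed.

Lemma past_increment_cross s t h i j : i != j -> 0 <= s -> s < t ->
  past_measurable s h -> integrable_fun P h ->
  integrable_fun P (fun w => h w * (B i t w - B i s w) * (B j t w - B j s w)) /\
  \int[P]_w (h w * (B i t w - B i s w) * (B j t w - B j s w)) = 0.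
Proof.
move=> ij s0 st mh ih.
have [ihi _ _ _] := past_increment s0 st mh ih i.
have [Cm ind] := increment_independent_of_past j BM indB s0 st.
have [sY mean _] := brownian_increment_moments (BM j) s0 st.
have adh : adapted (past_and_others B j s) (fun w => h w * (B i t w - B i s w)).
  apply: measurable_funM (mh j) _; apply: measurable_funB; apply: adapted_others => //.
  - exact/eqP.
  - by rewrite (le_trans s0)// ltW.
  - exact/eqP.
have [iY EY] := independent_product Cm adh sY.1 ind ihi (square_integrable_integrable sY).
by split => //; rewrite EY mean mulr0.
Qed.

(** The arbitrary weight [h] stands in for conditioning: given the past, the increment has mean 0
    and variance rate [v], the sum of the squared weights. In the expanded square only the diagonal
    terms survive. *)
Lemma weighted_increment b s t h : 0 <= s -> s < t ->
  past_measurable s h -> integrable_fun P h ->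
  let dZ w := weighted b t w - weighted b s w in
  [/\ integrable_fun P (fun w => h w * dZ w),
    \int[P]_w (h w * dZ w) = 0,
    integrable_fun P (fun w => h w * dZ w ^+ 2) &
    \int[P]_w (h w * dZ w ^+ 2) = (\sum_(i < n) b i ^+ 2) * (t - s) * \int[P]_w h w].
Proof.
move=> s0 st mh ih dZ.
pose dB i w := B i t w - B i s w.
have dZE w : dZ w = \sum_(i < n) b i * dB i w.
  by rewrite /dZ /weighted -sumrB; apply: eq_bigr => i _; rewrite -mulrBr.
have pi := past_increment s0 st mh ih.
have [i1 E1] : integrable_fun P (fun w => \sum_(i < n) b i * (h w * dB i w)) /\
    \int[P]_w (\sum_(i < n) b i * (h w * dB i w)) = \sum_(i < n) \int[P]_w (b i * (h w * dB i w)).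
  by apply: integrable_fun_sum => i; apply: integrable_funZ; case: (pi i).
have hdZ : (fun w => h w * dZ w) = (fun w => \sum_(i < n) b i * (h w * dB i w)).
  by apply/funext => w; rewrite dZE mulr_sumr; apply: eq_bigr => i _; rewrite mulrCA.
have cross i j : integrable_fun P (fun w => h w * dB i w * dB j w) /\
  \int[P]_w (h w * dB i w * dB j w) = (i == j)%:R * ((t - s) * \int[P]_w h w).
  have [->|ij] := eqVneq i j.
    have [_ _ iY2 EY2] := pi j; rewrite mul1r -EY2.
    split; last by apply: eq_Rintegral => w _; rewrite -mulrA -expr2.
    by apply: eq_integrable_fun iY2 => w; rewrite -mulrA -expr2.
  by rewrite mul0r; exact: past_increment_cross.
have hdZ2 : (fun w => h w * dZ w ^+ 2) =
    (fun w => \sum_(i < n) \sum_(j < n) (b i * b j) * (h w * dB i w * dB j w)).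
  apply/funext => w; rewrite dZE expr2 mulr_suml mulr_sumr; apply: eq_bigr => i _.
  rewrite !mulr_sumr; apply: eq_bigr => j _; ring.
have i2 i : integrable_fun P (fun w => \sum_(j < n) (b i * b j) * (h w * dB i w * dB j w)) /\
   \int[P]_w (\sum_(j < n) (b i * b j) * (h w * dB i w * dB j w)) =
   b i ^+ 2 * ((t - s) * \int[P]_w h w).
  have [|iS ES] := @integrable_fun_sum _ _ _ P _ (index_enum 'I_n) (fun j w => (b i * b j) * (h w * dB i w * dB j w)).
    by move=> j; apply: integrable_funZ; case: (cross i j).
  split => //; rewrite ES (bigD1 i)//= RintegralZl//; last by case: (cross i i).
  rewrite (cross i i).2 eqxx mul1r big1 ?addr0 ?expr2// => j ji.
  rewrite RintegralZl//; last by case: (cross i j).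
  by rewrite (cross i j).2 eq_sym (negbTE ji) mul0r mulr0.
have [|i3 E3] := @integrable_fun_sum _ _ _ P _ (index_enum 'I_n)
    (fun i w => \sum_(j < n) (b i * b j) * (h w * dB i w * dB j w)).
  by move=> i; case: (i2 i).
split.
- by rewrite hdZ.
- rewrite hdZ E1 big1// => i _; have [iY EY _ _] := pi i.
  by rewrite RintegralZl// EY mulr0.
- by rewrite hdZ2.
- rewrite hdZ2 E3 -mulrA mulr_suml; apply: eq_bigr => i _.
  by rewrite (i2 i).2.
Qed.

End weighted_sum.

(** * Discrete Wald identities for a walk whose steps are switched on by [K] *)

Section stopped_walk.
Context {d : measure_display} {T : measurableType d} {R : realType}.
Variable P : probability T R.
Variables (n : nat) (B : 'I_n -> R -> T -> R).
Hypothesis BM : forall i, standard_brownian_motion P (B i).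
Hypothesis indB : independent_processes P B.
Variables (a : R) (b : 'I_n -> R) (dt : R).
Hypothesis dt0 : 0 < dt.
Variable K : nat -> T -> bool.
Hypothesis K_past : forall j, past_measurable B (j%:R * dt) (fun w => (K j w)%:R).
Local Notation v := (\sum_(i < n) b i ^+ 2).

Definition walk_step (j : nat) (w : T) : R :=
  a * dt + (weighted B b (j.+1%:R * dt) w - weighted B b (j%:R * dt) w).

(** Switching the steps on and off, instead of summing up to a random index, makes every term the
    product of a factor known at time [j * dt] and a fresh step. *)
Definition stopped_walk (k : nat) (w : T) : R :=
  \sum_(j < k) (K j w)%:R * walk_step j w.

Definition stopped_clock (k : nat) (w : T) : R := \sum_(j < k) (K j w)%:R * dt.

Lemma walk_step_moments j h : past_measurable B (j%:R * dt) h -> integrable_fun P h ->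
  [/\ integrable_fun P (fun w => h w * walk_step j w),
    \int[P]_w (h w * walk_step j w) = a * dt * \int[P]_w h w,
    integrable_fun P (fun w => h w * walk_step j w ^+ 2) &
    \int[P]_w (h w * walk_step j w ^+ 2) =
      (a ^+ 2 * dt + v) * dt * \int[P]_w h w].
Proof.
move=> mh ih.
have tj0 : 0 <= j%:R * dt by rewrite mulr_ge0// ltW.
have tj : j%:R * dt < j.+1%:R * dt by rewrite ltr_pM2r// ltr_nat.
have [i1 E1 i2 E2] := weighted_increment BM indB b tj0 tj mh ih.
have tjE : j.+1%:R * dt - j%:R * dt = dt by rewrite -mulrBl -natrB// subSnn mul1r.
rewrite tjE in E2.
set dZ := fun w => weighted B b (j.+1%:R * dt) w - weighted B b (j%:R * dt) w in i1 E1 i2 E2.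
have hstep : (fun w => h w * walk_step j w) = (fun w => a * dt * h w + h w * dZ w).
  by apply/funext => w; rewrite /walk_step mulrDr mulrC.
have hstep2 : (fun w => h w * walk_step j w ^+ 2) =
    (fun w => (a * dt) ^+ 2 * h w + (2 * (a * dt) * (h w * dZ w) + h w * dZ w ^+ 2)).
  by apply/funext => w; rewrite /walk_step -/(dZ w); ring.
have ih1 := integrable_funZ (a * dt) ih.
have ih2 := integrable_funZ ((a * dt) ^+ 2) ih.
have ihz := integrable_funZ (2 * (a * dt)) i1.
have ihzz := integrable_funD ihz i2.
split.
- by rewrite hstep; exact: integrable_funD.
- by rewrite hstep RintegralD// RintegralZl// E1 addr0.
- by rewrite hstep2; exact: integrable_funD.
- rewrite hstep2 RintegralD// RintegralD// !RintegralZl// E1 E2; ring.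
Qed.

Lemma boolr_norm_le1 (c : bool) : `|c%:R : R| <= 1.
Proof. by case: c; rewrite ?normr1// normr0. Qed.

Lemma integrable_fun_boolM (c : T -> bool) (g : T -> R) :
  measurable_fun setT (fun w => (c w)%:R : R) -> integrable_fun P g ->
  integrable_fun P (fun w => (c w)%:R * g w).
Proof.
move=> mc ig; have ag : integrable_fun P (fun w => `|g w|) by exact: integrable_norm.
apply: integrable_fun_le ag.
  by apply: measurable_funM => //; exact: integrable_fun_measurable ig.
by move=> w; rewrite normrM ler_piMl// boolr_norm_le1.
Qed.

Lemma past_measurable_measurable s h : 0 <= s -> (0 < n)%N ->
  past_measurable B s h -> measurable_fun setT h.
Proof.
move=> s0 n0 mh; have i : 'I_n by exact: Ordinal n0.
have s1 : s < s + 1 by rewrite ltrDl.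
have [Cm _] := increment_independent_of_past i BM indB s0 s1.
exact: adapted_measurable Cm (mh i).
Qed.

Hypothesis n0 : (0 < n)%N.

Lemma K_measurable j : measurable_fun setT (fun w => (K j w)%:R : R).
Proof.
have s0 : 0 <= j%:R * dt by rewrite mulr_ge0// ltW.
exact: (past_measurable_measurable s0 n0 (@K_past j)).
Qed.

Lemma K_integrable j : integrable_fun P (fun w => (K j w)%:R : R).
Proof.
apply: integrable_fun_le (integrable_fun_cst P 1); first exact: K_measurable.
by move=> w; exact: boolr_norm_le1.
Qed.

Lemma stopped_walkS k w :
  stopped_walk k.+1 w = stopped_walk k w + (K k w)%:R * walk_step k w.
Proof. by rewrite /stopped_walk big_ord_recr. Qed.

Lemma stopped_clockS k w :
  stopped_clock k.+1 w = stopped_clock k w + (K k w)%:R * dt.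
Proof. by rewrite /stopped_clock big_ord_recr. Qed.

Lemma stopped_walk_past k : past_measurable B (k%:R * dt) (stopped_walk k).
Proof.
have gdt j m : (j <= m)%N -> 0 <= j%:R * dt <= m%:R * dt.
  move=> jm; apply/andP; split; first by rewrite mulr_ge0// ltW.
  by rewrite ler_pM2r// ler_nat.
elim: k => [|k IH].
  rewrite (_ : stopped_walk 0 = fun=> 0); first exact: past_measurable_cst.
  by apply/funext => w; rewrite /stopped_walk big_ord0.
rewrite (_ : stopped_walk k.+1 = fun w => stopped_walk k w + (K k w)%:R * walk_step k w); last first.
  by apply/funext => w; rewrite stopped_walkS.
have /andP[_ kk] := gdt k k.+1 (leqnSn k).
apply: past_measurableD; first exact: past_measurable_le kk IH.
apply: past_measurableM; first exact: past_measurable_le kk (@K_past k).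
apply: past_measurableD; first exact: past_measurable_cst.
apply: past_measurableD; first by apply: past_measurable_weighted; exact: gdt.
have mW : past_measurable B (k.+1%:R * dt) (weighted B b (k%:R * dt)).
  by apply: past_measurable_weighted; exact: gdt.
by move=> i; exact: measurable_funN (mW i).
Qed.

Lemma stopped_walk_square_integrable k : square_integrable P (stopped_walk k).
Proof.
elim: k => [|k IH].
  rewrite (_ : stopped_walk 0 = fun=> 0); first exact: square_integrable_cst.
  by apply/funext => w; rewrite /stopped_walk big_ord0.
rewrite (_ : stopped_walk k.+1 = fun w => stopped_walk k w + (K k w)%:R * walk_step k w); last first.
  by apply/funext => w; rewrite stopped_walkS.
apply: square_integrableD => //.
have [i1 _ i2 _] := walk_step_moments (@K_past k) (K_integrable k).
split; first exact: integrable_fun_measurable i1.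
apply: eq_integrable_fun i2 => w; rewrite exprMn.
by case: (K k w); rewrite ?expr1n// expr0n !mul0r.
Qed.

Lemma stopped_clock_integrable k : integrable_fun P (stopped_clock k) /\
  \int[P]_w stopped_clock k w = \sum_(j < k) dt * \int[P]_w (K j w)%:R.
Proof.
have [|i E] := @integrable_fun_sum _ _ _ P _ (index_enum 'I_k) (fun j w => (K j w)%:R * dt).
  move=> j; apply: eq_integrable_fun (integrable_funZ dt (K_integrable j)) => w.
  by rewrite mulrC.
split => //; rewrite [LHS]E; apply: eq_bigr => j _.
by rewrite -RintegralZl//; [apply: eq_Rintegral => w _; rewrite mulrC|exact: K_integrable].
Qed.

Lemma stopped_walk_mean k :
  \int[P]_w stopped_walk k w = a * \int[P]_w stopped_clock k w.
Proof.
rewrite (stopped_clock_integrable k).2 mulr_sumr.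
have [|_ ->] := @integrable_fun_sum _ _ _ P _ (index_enum 'I_k) (fun j w => (K j w)%:R * walk_step j w).
  by move=> j; case: (walk_step_moments (@K_past j) (K_integrable j)).
apply: eq_bigr => j _.
by have [_ -> _ _] := walk_step_moments (@K_past j) (K_integrable j); rewrite mulrA.
Qed.

(** A left-endpoint Riemann sum of the walk over its running time. The left endpoint is the one that
    appears when the square is expanded, the position before a step being known in advance. *)
Definition walk_area (k : nat) (w : T) : R :=
  \sum_(j < k) (K j w)%:R * stopped_walk j w * dt.

Lemma walk_area_integrable k : integrable_fun P (walk_area k).
Proof.
apply: (@integrable_fun_sum _ _ _ P _ (index_enum 'I_k)
  (fun j w => (K j w)%:R * stopped_walk j w * dt) _).1 => j.
apply: (@eq_integrable_fun _ _ _ _ (fun w => dt * ((K j w)%:R * stopped_walk j w))).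
  by move=> w; rewrite mulrC.
apply: integrable_funZ; apply: integrable_fun_boolM (K_measurable j) _.
exact: square_integrable_integrable (stopped_walk_square_integrable j).
Qed.

(** Since [K] is 0 or 1, step [k] adds [2 K X xi + K xi^2] to the square. The first term has mean
    [2 a dt E (K X)], an increment of the area term; the second has mean [(a^2 dt + v) dt E K],
    whose part in [a^2 dt] disappears as the mesh shrinks. *)
Lemma stopped_walk_second_moment k :
  \int[P]_w (stopped_walk k w ^+ 2) =
  2 * a * \int[P]_w walk_area k w + (a ^+ 2 * dt + v) * \int[P]_w stopped_clock k w.
Proof.
elim: k => [|k IH].
  have z (g : T -> R) : g =1 cst 0 -> \int[P]_w g w = 0.
    by move=> g0; under eq_Rintegral do rewrite g0; rewrite /Rintegral integral0.
  rewrite !z ?mulr0 ?addr0// => w; rewrite ?/stopped_clock ?/walk_area ?/stopped_walk big_ord0//=.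
  by rewrite expr0n.
have iKX : integrable_fun P (fun w => (K k w)%:R * stopped_walk k w).
  apply: integrable_fun_boolM (K_measurable k) _.
  exact: square_integrable_integrable (stopped_walk_square_integrable k).
have mKX : past_measurable B (k%:R * dt) (fun w => (K k w)%:R * stopped_walk k w).
  by apply: past_measurableM (@K_past k) (@stopped_walk_past k).
have [i1 E1 _ _] := walk_step_moments mKX iKX.
have [_ _ i2 E2] := walk_step_moments (@K_past k) (K_integrable k).
have [iS _] := stopped_clock_integrable k.
have iA := walk_area_integrable k.
have iK := K_integrable k.
have iX := (stopped_walk_square_integrable k).2.
have -> : \int[P]_w stopped_clock k.+1 w = \int[P]_w stopped_clock k w + dt * \int[P]_w (K k w)%:R.
  by rewrite !(stopped_clock_integrable _).2 big_ord_recr.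
have -> : \int[P]_w walk_area k.+1 w = \int[P]_w walk_area k w +
    dt * \int[P]_w ((K k w)%:R * stopped_walk k w).
  rewrite -RintegralZl// -RintegralD//; last exact: integrable_funZ.
  by apply: eq_Rintegral => w _; rewrite /walk_area big_ord_recr/= [dt * _]mulrC.
have -> : \int[P]_w (stopped_walk k.+1 w ^+ 2) = \int[P]_w (stopped_walk k w ^+ 2) +
   (2 * \int[P]_w ((K k w)%:R * stopped_walk k w * walk_step k w) +
    \int[P]_w ((K k w)%:R * walk_step k w ^+ 2)).
  have i1' := integrable_funZ 2 i1.
  rewrite -RintegralZl// -RintegralD// -RintegralD//; last exact: integrable_funD.
  apply: eq_Rintegral => w _; rewrite stopped_walkS.
  by case: (K k w) => /=; rewrite ?mulr1n ?mulr0n; ring.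
rewrite IH E1 E2; ring.
Qed.

End stopped_walk.

(** * Doob's maximal inequality for the driftless walk *)

Section doob.
Context {d : measure_display} {T : measurableType d} {R : realType}.
Variable P : probability T R.
Variables (n : nat) (B : 'I_n -> R -> T -> R).
Hypothesis BM : forall i, standard_brownian_motion P (B i).
Hypothesis indB : independent_processes P B.
Variables (b : 'I_n -> R) (dt : R).
Hypothesis dt0 : 0 < dt.
Variable K : nat -> T -> bool.
Hypothesis K_past : forall j, past_measurable B (j%:R * dt) (fun w => (K j w)%:R).
Hypothesis n0 : (0 < n)%N.
Local Notation v := (\sum_(i < n) b i ^+ 2).
Local Notation X := (stopped_walk B 0 b dt K).

Fixpoint running_max (k : nat) (w : T) : R :=
  if k is k'.+1 then Num.max (running_max k' w) `|X k w| else 0.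

(** A subgradient of the absolute value, written through an indicator so that measurability is
    immediate; [walk_abs_step] is the corresponding convexity inequality. *)
Definition sgn1 (x : R) : R := 2 * \1_(`[0%R, +oo[%classic : set R) x - 1.

Lemma sgn1E x : sgn1 x = if 0 <= x then 1 else -1.
Proof.
rewrite /sgn1 indicE; case: ifPn => x0.
  have -> : x \in (`[0%R, +oo[%classic : set R) by rewrite mem_set//= in_itv/= x0.
  by rewrite mulr1; ring.
have -> : x \in (`[0%R, +oo[%classic : set R) = false.
  by apply: memNset; rewrite /= in_itv/= andbT; exact/negP.
by rewrite mulr0 add0r.
Qed.

Lemma running_max_ge0 k w : 0 <= running_max k w.
Proof. by elim: k => //= k IH; rewrite le_max IH. Qed.

Lemma running_max_ge j k w : (0 < j <= k)%N -> `|X j w| <= running_max k w.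
Proof.
elim: k => [|k IH]; first by case: j.
move=> /andP[j0]; rewrite leq_eqVlt => /predU1P[->|jk] /=.
  by rewrite le_max lexx orbT.
by rewrite le_max IH// j0.
Qed.

Lemma walk_abs_step (x y : R) : sgn1 x * y <= `|x + y| - `|x|.
Proof.
rewrite sgn1E; case: ifPn => x0.
  rewrite (ger0_norm x0) mul1r lerBrDl; exact: ler_norm.
rewrite -ltNge in x0; rewrite (ltr0_norm x0).
by have := ler_norm (- (x + y)); rewrite normrN; lra.
Qed.

(* The left-hand side has mean zero, so integrating gives Doob's L2 inequality. *)
Lemma pathwise_doob k w :
  \sum_(i < k) running_max i w * sgn1 (X i w) * (K i w)%:R * walk_step B 0 b dt i w <=
  X k w ^+ 2 - running_max k w ^+ 2 / 4.
Proof.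
(* The quantity [M |X| - M^2 / 2] suits the induction because the maximum [M] changes only at steps
   where its new value is [|X|]; there the excess is half the square of the jump of [M]. *)
have : \sum_(i < k) running_max i w * sgn1 (X i w) * (K i w)%:R * walk_step B 0 b dt i w <=
  running_max k w * `|X k w| - running_max k w ^+ 2 / 2.
  elim: k => [|k IH]; first by rewrite big_ord0 /= mul0r expr0n mul0r subr0.
  rewrite big_ord_recr /=.
  have st : running_max k w * sgn1 (X k w) * (K k w)%:R * walk_step B 0 b dt k w <=
      running_max k w * (`|X k.+1 w| - `|X k w|).
    rewrite stopped_walkS -!mulrA ler_wpM2l ?running_max_ge0//.
    exact: walk_abs_step.
  apply: le_trans (lerD IH st) _.
  have [le|le] := leP (running_max k w) `|X k.+1 w|.
    by have := sqr_ge0 (running_max k w - `|X k.+1 w|); lra.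
  by lra.
move=> /le_trans; apply.
(* The square of [|X| - M / 2] gives [M |X| <= X^2 + M^2 / 4], whence the final constant 4. *)
rewrite -[X k w ^+ 2]real_normK ?num_real//.
by have := sqr_ge0 (`|X k w| - running_max k w / 2); lra.
Qed.

Lemma running_max_past k : past_measurable B (k%:R * dt) (running_max k).
Proof.
elim: k => [|k IH]; first exact: past_measurable_cst.
have kk : k%:R * dt <= k.+1%:R * dt by rewrite ler_pM2r// ler_nat.
apply: past_measurable_max; first exact: past_measurable_le kk IH.
have mX := stopped_walk_past 0 b dt0 K_past (k:=k.+1).
move=> i; exact: (measurableT_comp (@normr_measurable _ _) (mX i)).
Qed.

Lemma running_max_square_integrable k : square_integrable P (running_max k).
Proof.
have mM j : measurable_fun setT (running_max j).
  apply: (past_measurable_measurable BM indB _ n0 (@running_max_past j)).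
  by rewrite mulr_ge0// ltW.
elim: k => [|k IH]; first exact: square_integrable_cst.
split => //; have sX := stopped_walk_square_integrable BM indB 0 b dt0 K_past n0 k.+1.
apply: integrable_fun_le (integrable_funD IH.2 sX.2).
  by apply: measurable_funX; exact: mM.
move=> w; rewrite ger0_norm ?sqr_ge0// [running_max k.+1 w]/=.
have [_|_] := leP (running_max k w) `|X k.+1 w|; first by rewrite real_normK ?num_real// lerDr sqr_ge0.
by rewrite lerDl sqr_ge0.
Qed.

(** The weights in [pathwise_doob] are known before each step and the drift is 0, so its left-hand
    side integrates to 0. The second moment identity with [a = 0] evaluates [E X^2] as [v] times the
    mean clock. *)
Lemma doob_maximal k :
  \int[P]_w (running_max k w ^+ 2) <= 4 * v * \int[P]_w stopped_clock dt K k w.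
Proof.
have sX := stopped_walk_square_integrable BM indB 0 b dt0 K_past n0 k.
have sM := running_max_square_integrable k.
pose g i w := running_max i w * sgn1 (X i w) * (K i w)%:R.
have sgn_m : measurable_fun [set: R] sgn1.
  by apply: measurable_funB => //; apply: measurable_funM => //; exact: measurable_indic.
have ig i : past_measurable B (i%:R * dt) (g i) /\ integrable_fun P (g i).
  have pg : past_measurable B (i%:R * dt) (g i).
    apply: past_measurableM (@K_past i); apply: past_measurableM (@running_max_past i) _.
    exact: past_measurable_comp sgn_m (stopped_walk_past 0 b dt0 K_past (k:=i)).
  split => //.
  apply: integrable_fun_le (square_integrable_integrable (running_max_square_integrable i)).
    apply: (past_measurable_measurable BM indB _ n0 pg).
    by rewrite mulr_ge0// ltW.
  move=> w; rewrite /g !normrM (ger0_norm (running_max_ge0 _ _)) -mulrA.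
  rewrite ler_piMr ?running_max_ge0// mulr_ile1//; last exact: boolr_norm_le1.
  by rewrite sgn1E; case: ifP => _; rewrite ?normrN normr1.
have st i := walk_step_moments BM indB 0 b dt0 (ig i).1 (ig i).2.
have [|iS ES] := @integrable_fun_sum _ _ _ P _ (index_enum 'I_k)
    (fun i w => g i w * walk_step B 0 b dt i w).
  by move=> i; case: (st i).
have E0 : \int[P]_w (\sum_(i < k) g i w * walk_step B 0 b dt i w) = 0.
  by rewrite ES big1// => i _; have [_ -> _ _] := st i; rewrite !mul0r.
have : 0 <= \int[P]_w (X k w ^+ 2 - running_max k w ^+ 2 / 4).
  rewrite -[leLHS]E0; apply: le_Rintegral => //.
  - apply: integrable_funB; first exact: sX.2.
    by apply: eq_integrable_fun (integrable_funZ 4^-1 sM.2) => w; rewrite mulrC.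
  - by move=> w _; exact: pathwise_doob.
rewrite RintegralB//; last 2 first.
- exact: sX.2.
- by apply: eq_integrable_fun (integrable_funZ 4^-1 sM.2) => w; rewrite mulrC.
rewrite RintegralZr//; last exact: sM.2.
rewrite (stopped_walk_second_moment BM indB 0 b dt0 K_past n0).
rewrite expr0n /= mulr0 !mul0r !add0r; lra.
Qed.

End doob.

(** * Pathwise convergence of Riemann sums on dyadic grids *)

Section riemann_sums.
Context {R : realType}.
Local Notation mu := (@lebesgue_measure R).

Implicit Types (dt f p q c e : R) (K : nat -> bool).

Definition clock (dt : R) (K : nat -> bool) (k : nat) : R := \sum_(j < k) (K j)%:R * dt.

Lemma clockS dt K k : clock dt K k.+1 = clock dt K k + (K k)%:R * dt.
Proof. by rewrite /clock big_ord_recr. Qed.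

Lemma clock_ge0 dt K k : 0 <= dt -> 0 <= clock dt K k.
Proof. by move=> dt0; apply: sumr_ge0 => j _; rewrite mulr_ge0. Qed.

Lemma clock_all dt K k : (forall j, (j < k)%N -> K j) -> clock dt K k = k%:R * dt.
Proof.
move=> Kk; rewrite /clock (eq_bigr (fun=> dt)) ?sumr_const ?card_ord ?mulr_natl//.
by move=> j _; rewrite Kk// mul1r.
Qed.

(** The steps taken form an initial run, so the clock is [f] rounded up to the grid, cut off at the
    horizon [k * dt]. *)
Lemma clock_bounds dt f K k : 0 < dt -> 0 <= f -> (forall j, K j = (j%:R * dt < f)) ->
  Num.min f (k%:R * dt) <= clock dt K k <= f + dt.
Proof.
move=> dt0 f0 KE; elim: k => [|k /andP[IH1 IH2]].
  by rewrite mul0r /clock big_ord0 ge_min lexx orbT /= addr_ge0// ltW.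
rewrite clockS; case Kk : (K k).
  have ck : clock dt K k = k%:R * dt.
    apply: clock_all => j jk; rewrite KE; move: Kk; rewrite KE => /(le_lt_trans _); apply.
    by rewrite ler_pM2r// ler_nat ltnW.
  have kE : k%:R * dt + dt = k.+1%:R * dt by rewrite -natr1 mulrDl mul1r.
  by rewrite ck mul1r kE ge_min lexx orbT /= -kE lerD2r ltW// -KE.
move/negbT : Kk; rewrite KE -leNgt => fk.
rewrite mul0r addr0 IH2 andbT; apply: le_trans IH1.
by rewrite le_min !ge_min lexx fk.
Qed.

Lemma dyadic_cvg0 : (fun m : nat => (2^-1 : R) ^+ m) @ \oo --> (0 : R).
Proof. by apply: cvg_expr; rewrite ger0_norm// invf_lt1// ltr1n. Qed.

(** The number of steps [m * 2 ^ m] at mesh [2^-m] covers [[0, m]]: the mesh shrinks while the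
    horizon grows, and the cut-off disappears once [m] exceeds [f]. *)
Lemma clock_cvg f (K : nat -> nat -> bool) : 0 <= f ->
  (forall m j, K m j = (j%:R * 2^-1 ^+ m < f)) ->
  \forall m \near \oo, f <= clock (2^-1 ^+ m) (K m) (m * 2 ^ m) <= f + 2^-1 ^+ m.
Proof.
move=> f0 KE; near=> m.
have dt0 : 0 < (2^-1 : R) ^+ m by rewrite exprn_gt0.
have /andP[] := clock_bounds (m * 2 ^ m) dt0 f0 (KE m).
have -> : (m * 2 ^ m)%:R * (2^-1 : R) ^+ m = m%:R.
  by rewrite natrM natrX -mulrA -exprMn divff// expr1n mulr1.
have fm : f <= m%:R by near: m; exact: nbhs_infty_ger.
by rewrite (min_idPl fm) => -> ->.
Unshelve. all: by end_near. Qed.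

(** Uniform continuity by compactness of [[0, c]]. Only [x] is confined to the segment: the point
    [u] may leave it, since the last grid step passes beyond the stopping time. *)
Lemma continuous_dyadic_uniform (y : R -> R) (c e : R) : continuous y -> 0 < e ->
  \forall m \near \oo, forall x, 0 <= x <= c -> forall u, `|u - x| <= 2^-1 ^+ m ->
    `|y u - y x| <= e.
Proof.
move=> cy e0.
have /compact_near_coveringP cov := @segment_compact R 0 c.
have [|M _ HM] := cov nat \oo (fun m x => forall u, `|u - x| <= 2^-1 ^+ m -> `|y u - y x| <= e) _.
  move=> x _; have e20 : 0 < e / 2 by rewrite divr_gt0.
  have /cvgrPdist_lt/(_ _ e20)[r /= r0 Hr] := cy x.
  have r20 : 0 < r / 2 by rewrite divr_gt0.
  near=> x' m => u ux'.
  have x'x : `|x - x'| < r / 2 by near: x'; exact: nbhsx_ballx.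
  have dm : (2^-1 : R) ^+ m < r / 2.
    near: m; have /cvgrPdist_lt/(_ _ r20) := dyadic_cvg0.
    by apply: filterS => m; rewrite sub0r normrN ger0_norm// exprn_ge0.
  have ux : `|x - u| < r.
    rewrite (_ : x - u = (x - x') - (u - x')); last by ring.
    by rewrite (le_lt_trans (ler_normB _ _))// [ltRHS](splitr r) ltrD// (le_lt_trans ux').
  have h1 := Hr u ux.
  have h2 : `|y x - y x'| < e / 2 by apply: Hr; rewrite /= (lt_trans x'x)// gtr_pMr// invf_lt1// ltr1n.
  rewrite (_ : y u - y x' = (y x - y x') - (y x - y u)); last by ring.
  by rewrite (le_trans (ler_normB _ _))// [leRHS](splitr e) lerD// ltW.
exists M => // m /= Mm x xc; apply: (HM m Mm x).
Unshelve. all: by end_near. Qed.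

Variable y : R -> R.
Hypothesis cy : continuous y.
Local Notation I u := (\int[mu]_(t in `[0%R, u]) y t).

Lemma continuous_integrable_itv p q : mu.-integrable `[p, q] (EFin \o y).
Proof.
apply: continuous_compact_integrable; first exact: segment_compact.
exact: continuous_subspaceT.
Qed.

Lemma integral_step p q c e : 0 <= p -> p <= q ->
  (forall t, p <= t <= q -> `|y t - c| <= e) ->
  `|I q - I p - (q - p) * c| <= (q - p) * e.
Proof.
move=> p0 pq yc.
have icst k : mu.-integrable `[p, q] (EFin \o (fun=> k)).
  apply: continuous_compact_integrable; first exact: segment_compact.
  by move=> x; exact: cvg_cst.
have cstE k : \int[mu]_(t in `[p, q]) k = (q - p) * k.
  by rewrite Rintegral_cst//= lebesgue_measure_itv/= lte_fin; case: ltP => /= pq';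
    [rewrite mulrC|rewrite mulr0 (_ : q - p = 0) ?mul0r//; apply/eqP; rewrite subr_eq0 eq_le pq pq'].
have -> : I q - I p = \int[mu]_(t in `[p, q]) y t.
  rewrite (Rintegral_itvB (continuous_integrable_itv 0 q)) ?bnd_simp//.
  rewrite Rintegral_itv_obnd_cbnd//; apply: integrableS (continuous_integrable_itv p q) => //.
  by apply: subset_itvr; rewrite bnd_simp.
rewrite -!cstE -(RintegralB _ (continuous_integrable_itv p q) (icst c))//.
have iB : mu.-integrable `[p, q] (EFin \o (fun t => y t - c)).
  by apply: (integrableB _ (continuous_integrable_itv p q) (icst c)).
apply: (le_trans (le_normr_Rintegral _ iB)) => //.
by apply: le_Rintegral => //; exact: integrable_norm.
Qed.

(** Each step taken contributes an error of at most [dt * e], and the lengths of these steps add up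
    to the clock. *)
Lemma riemann_sum_error dt f K k e : 0 < dt -> 0 <= e ->
  (forall j, K j = (j%:R * dt < f)) ->
  (forall x, 0 <= x <= f -> forall u, `|u - x| <= dt -> `|y u - y x| <= e) ->
  `|\sum_(j < k) (K j)%:R * y (j%:R * dt) * dt - I (clock dt K k)| <= clock dt K k * e.
Proof.
move=> dt0 e0 KE ye; elim: k => [|k IH].
  by rewrite big_ord0 /clock big_ord0 set_itv1 Rintegral_set1 subrr normr0 mul0r.
rewrite big_ord_recr /= clockS; case Kk : (K k); last by rewrite !mul0r !addr0.
have kf : k%:R * dt < f by rewrite -KE.
have ck : clock dt K k = k%:R * dt.
  apply: clock_all => j jk; rewrite KE (le_lt_trans _ kf)//.
  by rewrite ler_pM2r// ler_nat ltnW.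
have kdt0 : 0 <= k%:R * dt by rewrite mulr_ge0// ltW.
rewrite !mul1r.
have := @integral_step (clock dt K k) (clock dt K k + dt) (y (k%:R * dt)) e.
have -> : clock dt K k + dt - clock dt K k = dt by ring.
have H1 : 0 <= clock dt K k by rewrite ck.
have H2 : clock dt K k <= clock dt K k + dt by rewrite lerDl ltW.
have H3 t : clock dt K k <= t <= clock dt K k + dt -> `|y t - y (k%:R * dt)| <= e.
  rewrite ck => /andP[kt tk]; apply: ye; first by rewrite kdt0 ltW.
  by rewrite ger0_norm ?subr_ge0// lerBlDl.
move/(_ H1 H2 H3); set S := \sum_(_ < _) _; set I1 := I _; set I0 := I _ in IH *.
move=> H.
rewrite (_ : S + y (k%:R * dt) * dt - I1 = (S - I0) - (I1 - I0 - dt * y (k%:R * dt))); last by ring.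
by rewrite (le_trans (ler_normB _ _))// mulrDl lerD.
Qed.

Lemma riemann_sum_cvg f (K : nat -> nat -> bool) : 0 <= f ->
  (forall m j, K m j = (j%:R * 2^-1 ^+ m < f)) ->
  (fun m => \sum_(j < m * 2 ^ m) (K m j)%:R * y (j%:R * 2^-1 ^+ m) * 2^-1 ^+ m) @ \oo
    --> I f.
Proof.
move=> f0 KE; apply/cvgrPdist_le => e e0.
(* There are two errors. Up to the clock, which is at most [f + 1], the sum is off by at most
   [(f + 1) * e1 <= e / 2]. On the overshoot from [f] to the clock, shorter than the mesh, the bound
   [e1 <= 1] keeps [y] within 1 of [y f]. *)
pose e1 := Num.min 1 (e / 2 / (f + 1)).
have f1 : 0 < f + 1 by rewrite ltr_wpDl ?ltr01.
have e10 : 0 < e1 by rewrite lt_min ltr01 !divr_gt0.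
have yf0 : 0 < e / 2 / (`|y f| + 1) by rewrite !divr_gt0 ?ltr_wpDl ?ltr01 ?normr_ge0.
near=> m.
have dt0 : 0 < (2^-1 : R) ^+ m by rewrite exprn_gt0.
have unif : forall x, 0 <= x <= f -> forall u, `|u - x| <= 2^-1 ^+ m -> `|y u - y x| <= e1.
  by near: m; exact: (@continuous_dyadic_uniform y f e1 cy e10).
have /andP[c1 c2] : f <= clock (2^-1 ^+ m) (K m) (m * 2 ^ m) <= f + 2^-1 ^+ m.
  by near: m; exact: clock_cvg.
have small : (2^-1 : R) ^+ m <= e / 2 / (`|y f| + 1).
  near: m; have /cvgrPdist_le/(_ _ yf0) := dyadic_cvg0.
  by apply: filterS => m; rewrite sub0r normrN ger0_norm// exprn_ge0.
have dt1 : (2^-1 : R) ^+ m <= 1 by rewrite exprn_ile1// invf_le1// ler1n.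
have := riemann_sum_error (m * 2 ^ m) dt0 (ltW e10) (KE m) unif.
set C := clock _ _ _ in c1 c2 *; set S := \sum_(_ < _) _ => H1.
have H2 : `|I C - I f - (C - f) * y f| <= (C - f) * e1.
  apply: integral_step => // t /andP[ft tC]; apply: unif; first by rewrite f0 lexx.
  by rewrite ger0_norm ?subr_ge0// lerBlDl (le_trans tC).
rewrite (_ : I f - S = (I C - S) - ((I C - I f - (C - f) * y f) + (C - f) * y f)); last by ring.
rewrite (le_trans (ler_normB _ _))// [leRHS](splitr e) lerD//.
  rewrite distrC (le_trans H1)// (@le_trans _ _ ((f + 1) * e1))//.
    by apply: ler_wpM2r; [exact: ltW|rewrite (le_trans c2)// lerD2l].
  by rewrite mulrC -ler_pdivlMr// ge_min lexx orbT.
rewrite (le_trans (ler_normD _ _))// normrM.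
have Cf : `|C - f| <= 2^-1 ^+ m by rewrite ger0_norm ?subr_ge0// lerBlDl.
have e1le : e1 <= 1 by rewrite ge_min lexx.
have H3 : (C - f) * e1 <= 2^-1 ^+ m * 1.
  by apply: ler_pM => //; [rewrite subr_ge0|exact: ltW|rewrite lerBlDl].
rewrite (@le_trans _ _ (2^-1 ^+ m * (`|y f| + 1)))//; last first.
  by rewrite -ler_pdivlMr// ltr_wpDl.
rewrite mulrDr addrC lerD//; last exact: le_trans H2 H3.
by rewrite ler_wpM2r.
Unshelve. all: by end_near. Qed.

End riemann_sums.

(** * Identification of the walk with the sampled path *)

Section pathwise_walk.
Context {d : measure_display} {T : measurableType d} {R : realType}.
Variable P : probability T R.
Variables (n : nat) (B : 'I_n -> R -> T -> R).
Hypothesis BM : forall i, standard_brownian_motion P (B i).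
Variables (a : R) (b : 'I_n -> R).
Implicit Types (dt f : R) (K : nat -> T -> bool) (w : T).

Lemma weighted0 w : weighted B b 0 w = 0.
Proof. by apply: big1 => i _; rewrite (bm_start (BM i)) mulr0. Qed.

(** When [K] is decreasing, the steps taken are the first [i] ones and the walk telescopes. The
    clause [K k w -> i = k] is the invariant that carries the induction: a walk still running stands
    at the current grid point. *)
Lemma stopped_walk_at_clock dt K w : (forall j, K j.+1 w -> K j w) ->
  forall k, exists2 i, (i <= k)%N &
    [/\ (forall l, (l < i)%N -> K l w), stopped_clock dt K k w = i%:R * dt,
        K k w -> i = k &
        stopped_walk B a b dt K k w = a * (i%:R * dt) + weighted B b (i%:R * dt) w].
Proof.
move=> Kdec; elim=> [|k [i ik [Ki ci iK wi]]].
  exists 0%N => //; split => //.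
    by rewrite /stopped_clock big_ord0 mul0r.
  by rewrite /stopped_walk big_ord0 mul0r mulr0 weighted0 addr0.
rewrite stopped_walkS stopped_clockS; case Kk : (K k w).
  have ek := iK Kk; exists k.+1 => //; split => //.
  - move=> l; rewrite ltnS leq_eqVlt => /predU1P[->//|lk]; apply: Ki.
    by rewrite ek.
  - by rewrite ci ek mul1r -natr1 mulrDl mul1r.
  - rewrite wi ek mul1r /walk_step -natr1 mulrDl mul1r; ring.
exists i; first exact: leqW.
split => //.
- by rewrite ci mul0r addr0.
- by move=> /Kdec; rewrite Kk.
- by rewrite wi mul0r addr0.
Qed.

Lemma walk_areaE dt K w k : (forall j, K j.+1 w -> K j w) ->
  walk_area B a b dt K k w =
  \sum_(j < k) (K j w)%:R * (a * (j%:R * dt) + weighted B b (j%:R * dt) w) * dt.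
Proof.
move=> Kdec; apply: eq_bigr => j _.
have [i _ [_ _ iK ->]] := stopped_walk_at_clock dt Kdec j.
by case Kj : (K j w); rewrite ?mul0r// iK.
Qed.

(* Extended by its value at 0 to negative times, so that it is continuous on the whole line. *)
Definition sample_path (w : T) (u : R) : R :=
  a * Num.max u 0 + weighted B b (Num.max u 0) w.

Lemma sample_pathE w u : 0 <= u -> sample_path w u = a * u + weighted B b u w.
Proof. by move=> u0; rewrite /sample_path (max_idPl u0). Qed.

(** The Brownian paths are continuous inside the positive half-line and from the right at 0;
    constancy at negative times supplies the other side at 0. *)
Lemma sample_path_continuous w : continuous (sample_path w).
Proof.
have cmax : continuous (fun u : R => Num.max u 0).
  by move=> u; apply: continuous_max; [exact: cvg_id|exact: cvg_cst].
have cB i : continuous (fun u : R => B i (Num.max u 0) w).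
  move=> u; have := @bm_continuous _ _ _ _ _ (BM i) w.
  move=> /continuous_within_itvcyP[cin c0].
  have [u0|u0|->] := ltgtP u 0.
  - have e : \forall z \near u, 0 = Num.max z 0.
      near=> z; apply/esym/max_idPr/ltW; near: z; exact: lt_nbhsl.
    rewrite /continuous_at (max_idPr (ltW u0)).
    apply: cvg_near_cst; near=> z; congr (B i _ w); apply/max_idPr/ltW.
    near: z; exact: lt_nbhsl.
  - rewrite /continuous_at (max_idPl (ltW u0)).
    have : B i z w @[z --> u] --> B i u w by apply: cin; rewrite in_itv/= u0.
    apply: cvg_trans; apply: near_eq_cvg; near=> z; congr (B i _ w).
    apply/esym/max_idPl/ltW; near: z; exact: lt_nbhsr.
  - rewrite /continuous_at maxxx.
    apply/cvgrPdist_lt => e e0.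
    have /cvgrPdist_lt/(_ e e0)[r /= r0 Hr] := c0.
    exists r => //= z zr.
    have [z0|z0] := ltP 0 z.
      exact: Hr.
    by rewrite subrr normr0.
move=> u; apply: cvgD.
  by apply: cvgM; [exact: cvg_cst|exact: cmax].
rewrite /weighted; elim: (index_enum 'I_n) => [|i r IH].
  by under eq_fun do rewrite big_nil; rewrite big_nil; exact: cvg_cst.
under eq_fun do rewrite big_cons; rewrite big_cons.
by apply: cvgD => //; apply: cvgM; [exact: cvg_cst|exact: cB].
Unshelve. all: by end_near. Qed.

(** The clock tends to [f], the walk is the continuous path evaluated at the clock, and the area is
    a Riemann sum of that path. *)
Lemma stopped_walk_cvg (K : nat -> nat -> T -> bool) w f : 0 <= f ->
  (forall m j, K m j w = (j%:R * 2^-1 ^+ m < f)) ->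
  [/\ (fun m => stopped_clock (2^-1 ^+ m) (K m) (m * 2 ^ m) w) @ \oo --> f,
      (fun m => stopped_walk B a b (2^-1 ^+ m) (K m) (m * 2 ^ m) w) @ \oo -->
        a * f + weighted B b f w &
      (fun m => walk_area B a b (2^-1 ^+ m) (K m) (m * 2 ^ m) w) @ \oo -->
        \int[lebesgue_measure]_(u in `[0, f]) (a * u + weighted B b u w)].
Proof.
move=> f0 KE.
have dt0 m : 0 < (2^-1 : R) ^+ m by rewrite exprn_gt0.
have Kdec m j : K m j.+1 w -> K m j w.
  by rewrite !KE => /(lt_trans _); apply; rewrite ltr_pM2r// ltr_nat.
have ccvg : (fun m => stopped_clock (2^-1 ^+ m) (K m) (m * 2 ^ m) w) @ \oo --> f.
  apply: (@squeeze_cvgr _ _ _ _ (cst f) (fun m => f + 2^-1 ^+ m)).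
  - exact: clock_cvg f0 KE.
  - exact: cvg_cst.
  - by rewrite -[X in _ --> X]addr0; apply: cvgD; [exact: cvg_cst|exact: dyadic_cvg0].
split => //.
- rewrite -sample_pathE//.
  have -> : (fun m => stopped_walk B a b (2^-1 ^+ m) (K m) (m * 2 ^ m) w) =
      (fun m => sample_path w (stopped_clock (2^-1 ^+ m) (K m) (m * 2 ^ m) w)).
    apply/funext => m.
    have [i _ [_ -> _ ->]] := stopped_walk_at_clock (2^-1 ^+ m) (Kdec m) (m * 2 ^ m).
    by rewrite sample_pathE// mulr_ge0// ltW.
  by apply: (cvg_comp _ _ ccvg); exact: sample_path_continuous.
- have -> : (fun m => walk_area B a b (2^-1 ^+ m) (K m) (m * 2 ^ m) w) =
      (fun m => \sum_(j < m * 2 ^ m) (K m j w)%:R * sample_path w (j%:R * 2^-1 ^+ m) * 2^-1 ^+ m).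
    apply/funext => m; rewrite (walk_areaE _ _ (Kdec m)); apply: eq_bigr => j _.
    by rewrite sample_pathE// mulr_ge0// ltW.
  have -> : \int[lebesgue_measure]_(u in `[0, f]) (a * u + weighted B b u w) =
      \int[lebesgue_measure]_(u in `[0, f]) sample_path w u.
    apply: eq_Rintegral => u.
    by rewrite inE/= in_itv/= => /andP[u0 _]; rewrite sample_pathE.
  by apply: (riemann_sum_cvg (@sample_path_continuous w) f0 (K := fun m j => K m j w)).
Qed.

End pathwise_walk.

Section real_dominated_convergence.
Context {d : measure_display} {T : measurableType d} {R : realType}.
Variable mu : {measure set T -> \bar R}.

(** The bound [G] takes extended values because the maximal function used below is a limit that may
    be infinite on a null set. *)
Lemma real_dominated_convergence (g : nat -> T -> R) (h : T -> R) (G : T -> \bar R) :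
  (forall m, measurable_fun setT (g m)) -> measurable_fun setT h ->
  {ae mu, forall w, (fun m => g m w) @ \oo --> h w} ->
  mu.-integrable setT G ->
  {ae mu, forall w, forall m, (`|g m w|%:E <= G w)%E} ->
  integrable_fun mu h /\ (fun m => \int[mu]_w g m w) @ \oo --> \int[mu]_w h w.
Proof.
move=> mg mh gh iG gG.
have [] := @dominated_convergence _ _ _ mu setT measurableT
  (fun m w => (g m w)%:E) (fun w => (h w)%:E) G.
- by move=> m; exact/measurable_EFinP.
- exact/measurable_EFinP.
- by apply: filterS gh => w gw _; apply: cvg_EFin => //; exact: nearW.
- exact: iG.
- by apply: filterS gG => w gw m _; exact: gw.
move=> ih _ ch; split; first exact: ih.
by apply: fine_cvg; rewrite fineK//; exact: integrable_fin_num.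
Qed.

End real_dominated_convergence.

(** * Wald identities in continuous time *)

Section wald.
Context {d : measure_display} {T : measurableType d} {R : realType}.
Variable P : probability T R.
Variables (n : nat) (B : 'I_n -> R -> T -> R).
Hypothesis BM : forall i, standard_brownian_motion P (B i).
Hypothesis indB : independent_processes P B.
Hypothesis n0 : (0 < n)%N.
Variable tau : T -> \bar R.
Hypothesis tau0 : forall w, (0 <= tau w)%E.
(** Stated for the enlarged pasts, so that the given stopping time and the hitting times of levels
    are treated alike. *)
Hypothesis tauS : forall (t : R) i, 0 <= t ->
  <<s past_and_others B i t >> [set w | (tau w <= t%:E)%E].
Hypothesis tau2 : (\int[P]_w (tau w ^+ 2) < +oo)%E.

Lemma measurable_stopping : measurable_fun setT tau.
Proof.
apply: (measurability _ (ErealGenOInfty.measurableE R)) => // _ [_ [x ->] <-].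
rewrite setTI (_ : _ @^-1` _ = ~` [set w | (tau w <= x%:E)%E]); last first.
  apply/seteqP; split=> w /=.
    by rewrite in_itv/= andbT => xw; apply/negP; rewrite -ltNge.
  by move/negP; rewrite -ltNge in_itv/= andbT.
apply: measurableC; have [x0|x0] := leP 0 x.
  have [Cm _] := increment_independent_of_past (Ordinal n0) BM indB x0 (ltr_pwDr ltr01 (lexx x)).
  exact: (sigma_sub_measurable Cm (@tauS x (Ordinal n0) x0)).
rewrite (_ : [set w | _] = set0)//; apply/seteqP; split=> // w /= wx.
by have := le_trans (tau0 w) wx; rewrite lee_fin leNgt x0.
Qed.

Lemma measurable_stopping_sqr : measurable_fun setT (fun w => tau w ^+ 2)%E.
Proof.
under eq_fun do rewrite expe2.
by apply: emeasurable_funM; exact: measurable_stopping.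
Qed.

Lemma stopping_integrable : P.-integrable setT tau.
Proof.
apply/integrableP; split; first exact: measurable_stopping.
have m2 := measurable_stopping_sqr.
have s0 w : (0 <= tau w ^+ 2)%E by rewrite expe2 mule_ge0.
apply: (@le_lt_trans _ _ (\int[P]_w (1 + tau w ^+ 2))%E).
  apply: ge0_le_integral => //.
  - by apply: measurableT_comp => //; exact: measurable_stopping.
  - exact: emeasurable_funD.
  move=> w _; rewrite gee0_abs// expe2; case: (tau w) (tau0 w) => [r| |]//=.
  rewrite !lee_fin => r0; nra.
rewrite ge0_integralD// integral_cst//= probability_setT mule1 lte_add_pinfty//.
by rewrite ltry.
Qed.

Lemma stopping_ae_finite : {ae P, forall w, tau w \is a fin_num}.
Proof. by have := integrable_ae measurableT stopping_integrable; apply: filterS => w; exact. Qed.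

Lemma fine_stopping_measurable : measurable_fun setT (fun w => fine (tau w)).
Proof.
by apply: measurableT_comp => //; exact: measurable_stopping.
Qed.

Lemma fine_stopping_ge0 w : 0 <= fine (tau w).
Proof. exact: fine_ge0. Qed.

Lemma fine_stopping_square : square_integrable P (fun w => fine (tau w)).
Proof.
split; first exact: fine_stopping_measurable.
apply/integrableP; split.
  by apply/measurable_EFinP; apply: measurable_funX; exact: fine_stopping_measurable.
apply: le_lt_trans tau2; apply: ge0_le_integral => //.
- apply: measurableT_comp => //; apply/measurable_EFinP.
  by apply: measurable_funX; exact: fine_stopping_measurable.
- exact: measurable_stopping_sqr.
move=> w _; rewrite expe2 /= ger0_norm ?sqr_ge0//.
by case: (tau w) (tau0 w) => [r| |] //= _; rewrite expr2// mul0r leey.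
Qed.

Lemma integral_fine_stopping : (\int[P]_w tau w = (\int[P]_w fine (tau w))%:E)%E.
Proof.
rewrite /Rintegral fineK; last first.
  apply: integrable_fin_num => //.
  exact: square_integrable_integrable fine_stopping_square.
apply: ae_eq_integral => //.
- exact: measurable_stopping.
- by apply/measurable_EFinP; exact: fine_stopping_measurable.
- by apply: filterS stopping_ae_finite => w fw _; rewrite fineK.
Qed.

(** The strict inequality makes this the complement of an event known at the left end of step [j];
    within the horizon, the walk stops at the first grid point not before [tau]. *)
Definition before (m j : nat) (w : T) : bool := ((j%:R * 2^-1 ^+ m)%:E < tau w)%E.

(* Stopping just before [tau + 1] at the right end of each dyadic interval makes the
   visited grids nested in [m], hence [dyadic_max] nondecreasing in [m]; the event is
   still in the past of the left end because the mesh is at most 1. *)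
Definition before_plus1 (m j : nat) (w : T) : bool :=
  ((j.+1%:R * 2^-1 ^+ m - 1)%:E < tau w)%E.

Lemma dyadic_gt0 m : 0 < (2^-1 : R) ^+ m. Proof. by rewrite exprn_gt0. Qed.

Lemma dyadic_le1 m : (2^-1 : R) ^+ m <= 1.
Proof. by rewrite exprn_ile1// invf_le1// ler1n. Qed.

Lemma after_past (s t : R) : s <= t -> 0 <= t ->
  past_measurable B t (fun w => (s%:E < tau w)%E%:R).
Proof.
move=> st t0.
rewrite (_ : (fun w => _) = \1_(~` [set w | (tau w <= s%:E)%E])); last first.
  apply/funext => w; rewrite indicE; congr (nat_of_bool _)%:R.
  apply/idP/idP => [sw|/set_mem /= /negP]; last by rewrite -ltNge.
  by apply/mem_set; rewrite /= ; apply/negP; rewrite -ltNge.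
apply: past_measurable_indic => i.
apply: (@measurableC _ (g_sigma_algebraType (past_and_others B i t))).
have [s0|s0] := leP 0 s.
  (* The event is carried from the past of [s] to that of [t] through its indicator, and read back
     as the preimage of 1. *)
  have : past_measurable B s (\1_[set w | (tau w <= s%:E)%E]).
    by apply: past_measurable_indic => j; exact: tauS.
  move=> /(past_measurable_le st)/(_ i measurableT [set 1] (measurable_set1 _)).
  rewrite setTI; congr (measurable _); apply/seteqP; split => w /=; rewrite indicE.
    by case: (boolP (w \in _)) => [/set_mem//|_ /esym/eqP]; rewrite oner_eq0.
  by move=> ws; rewrite mem_set.
rewrite (_ : [set w | _] = set0).
  exact: (@measurable0 _ (g_sigma_algebraType _)).
apply/seteqP; split=> // w /= ws.
by have := le_trans (tau0 w) ws; rewrite lee_fin leNgt s0.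
Qed.

Lemma before_past m j : past_measurable B (j%:R * 2^-1 ^+ m) (fun w => (before m j w)%:R).
Proof. by apply: after_past => //; rewrite mulr_ge0// ltW// dyadic_gt0. Qed.

Lemma before_plus1_past m j :
  past_measurable B (j%:R * 2^-1 ^+ m) (fun w => (before_plus1 m j w)%:R).
Proof.
apply: after_past; last by rewrite mulr_ge0// ltW// dyadic_gt0.
by rewrite -natr1 mulrDl mul1r -addrA gerDl subr_le0 dyadic_le1.
Qed.

Lemma beforeE m j w : tau w \is a fin_num -> before m j w = (j%:R * 2^-1 ^+ m < fine (tau w)).
Proof. by move=> fw; rewrite /before -{1}(fineK fw) lte_fin. Qed.

Lemma before_decr m j w : before m j.+1 w -> before m j w.
Proof.
by apply: lt_trans; rewrite lte_fin ltr_pM2r ?dyadic_gt0// ltr_nat.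
Qed.

Lemma before_plus1_decr m j w : before_plus1 m j.+1 w -> before_plus1 m j w.
Proof.
by apply: lt_trans; rewrite lte_fin ltrD2r ltr_pM2r ?dyadic_gt0// ltr_nat.
Qed.

Variables (a : R) (b : 'I_n -> R).
Local Notation v := (\sum_(i < n) b i ^+ 2).
Local Notation Z := (weighted B b).

Definition dyadic_max m w := running_max B b (2^-1 ^+ m) (before_plus1 m) (m * 2 ^ m) w.

(** Grid point [i] is reached by step [i - 1], whose condition in [before_plus1] says precisely that
    this point precedes [tau + 1]; at point 0 the path vanishes. *)
Lemma dyadic_max_ge m i w : (i <= m * 2 ^ m)%N -> ((i%:R * 2^-1 ^+ m - 1)%R%:E < tau w)%E ->
  `|Z (i%:R * 2^-1 ^+ m) w| <= dyadic_max m w.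
Proof.
case: i => [|i] im it; first by rewrite mul0r (weighted0 BM) normr0 running_max_ge0.
have [i' i'm [_ _ iK wE]] := stopped_walk_at_clock BM 0 b (2^-1 ^+ m) (@before_plus1_decr m ^~ w) i.
have Ki : before_plus1 m i w by exact: it.
have := running_max_ge B b (2^-1 ^+ m) (before_plus1 m) (j := i.+1) (k := m * 2 ^ m) w.
rewrite im => /(_ isT); apply: le_trans.
rewrite stopped_walkS wE (iK Ki) Ki mul1r /walk_step !mul0r !add0r subrKC.
by rewrite lexx.
Qed.

(** Grid point [i] of one mesh is point [2 i] of the next. The condition on a right end depends only
    on its time, so a point visited by the coarse walk is visited by the fine one. *)
Lemma dyadic_max_nd m w : dyadic_max m w <= dyadic_max m.+1 w.
Proof.
suff : forall k, (k <= m * 2 ^ m)%N ->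
    running_max B b (2^-1 ^+ m) (before_plus1 m) k w <= dyadic_max m.+1 w by exact.
elim=> [|k IH] km; first exact: running_max_ge0.
rewrite /= ge_max IH ?(ltnW km)//=.
have [i ik [Ki _ _ ->]] := stopped_walk_at_clock BM 0 b (2^-1 ^+ m) (@before_plus1_decr m ^~ w) k.+1.
rewrite mul0r add0r.
case: i ik Ki => [|i] ik Ki; first by rewrite mul0r (weighted0 BM) normr0 running_max_ge0.
have -> : i.+1%:R * (2^-1 : R) ^+ m = (i.+1 * 2)%:R * 2^-1 ^+ m.+1.
  by rewrite natrM exprS mulrA mulfK.
apply: dyadic_max_ge.
  rewrite expnS mulnCA mulnA [(_ * 2)%N]mulnC -mulnA leq_pmul2l//.
  by rewrite (leq_trans ik)// (leq_trans km)// leq_mul2r leqnSn orbT.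
have -> : (i.+1 * 2)%:R * (2^-1 : R) ^+ m.+1 = i.+1%:R * 2^-1 ^+ m.
  by rewrite natrM exprS mulrA mulfK.
exact: (Ki i).
Qed.

Local Notation Ef := (\int[P]_w fine (tau w)).
Local Notation clk m := (stopped_clock ((2^-1 : R) ^+ m) (before m) (m * 2 ^ m)).
Local Notation X m := (stopped_walk B a b (2^-1 ^+ m) (before m) (m * 2 ^ m)).
Local Notation A m := (walk_area B a b (2^-1 ^+ m) (before m) (m * 2 ^ m)).

Lemma clock_plus1_le m k w :
  ((stopped_clock (2^-1 ^+ m) (before_plus1 m) k w)%:E <= tau w + 1)%E.
Proof.
have [i _ [Ki -> _ _]] := stopped_walk_at_clock BM 0 b (2^-1 ^+ m) (@before_plus1_decr m ^~ w) k.
case: i Ki => [|i] Ki; first by rewrite mul0r adde_ge0.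
have := Ki i (ltnSn i); rewrite /before_plus1.
case: (tau w) => [r| |]//=.
  by rewrite lte_fin -EFinD lee_fin ltrBlDr => /ltW.
by rewrite addye// leey.
Qed.

Lemma dyadic_max_integral m :
  (\int[P]_w (dyadic_max m w ^+ 2)%:E <= (4 * v * (Ef + 1))%:E)%E.
Proof.
have [_ iM] := running_max_square_integrable BM indB b (dyadic_gt0 m)
  (@before_plus1_past m) n0 (m * 2 ^ m).
have [iC _] := stopped_clock_integrable BM indB (dyadic_gt0 m)
  (@before_plus1_past m) n0 (m * 2 ^ m).
have := doob_maximal BM indB b (dyadic_gt0 m) (@before_plus1_past m) n0 (m * 2 ^ m).
have fM : (\int[P]_w (dyadic_max m w ^+ 2)%:E)%E \is a fin_num by exact: integrable_fin_num.
move=> H; rewrite -(fineK fM) lee_fin (le_trans H)// ler_wpM2l//.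
  by rewrite mulr_ge0// sumr_ge0// => i _; exact: sqr_ge0.
rewrite -lee_fin EFinD -integral_fine_stopping /Rintegral fineK; last exact: integrable_fin_num.
have -> : (\int[P]_w tau w + 1 = \int[P]_w (tau w + 1))%E.
  rewrite integralD//; [|exact: stopping_integrable|exact: finite_measure_integrable_cst].
  by rewrite integral_cst//= probability_setT mule1.
apply: ge0_le_integral => //.
- move=> w _; rewrite lee_fin.
  exact: (clock_ge0 (before_plus1 m ^~ w) (m * 2 ^ m) (ltW (dyadic_gt0 m))).
- by apply/measurable_EFinP; exact: integrable_fun_measurable iC.
- by apply: emeasurable_funD => //; exact: measurable_stopping.
- by move=> w _; exact: clock_plus1_le.
Qed.

(** The supremum of the squared driftless path over the dyadic times before [tau + 1], as a monotone
    limit. *)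
Definition maximal_sqr w : \bar R := limn (fun m => (dyadic_max m w ^+ 2)%:E).

Lemma dyadic_max_sqr_nd w : nondecreasing_seq (fun m => (dyadic_max m w ^+ 2)%:E).
Proof.
apply/nondecreasing_seqP => m; rewrite lee_fin ler_sqr ?nnegrE ?running_max_ge0//.
exact: dyadic_max_nd.
Qed.

Lemma dyadic_max_sqr_measurable m : measurable_fun setT (fun w => (dyadic_max m w ^+ 2)%:E).
Proof.
have [_ iM] := running_max_square_integrable BM indB b (dyadic_gt0 m)
  (@before_plus1_past m) n0 (m * 2 ^ m).
by apply/measurable_EFinP; exact: integrable_fun_measurable iM.
Qed.

Lemma maximal_sqr_ge m w : ((dyadic_max m w ^+ 2)%:E <= maximal_sqr w)%E.
Proof.
rewrite /maximal_sqr (cvg_lim _ (ereal_nondecreasing_cvgn (@dyadic_max_sqr_nd w)))//.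
by apply: ereal_sup_ubound; exists m.
Qed.

(** Doob's bound [4 v (E tau + 1)] does not depend on the mesh, so monotone convergence carries it
    to the limit. *)
Lemma maximal_sqr_integrable : P.-integrable setT maximal_sqr.
Proof.
have mm : measurable_fun setT maximal_sqr.
  apply: (emeasurable_fun_cvg (fun m w => (dyadic_max m w ^+ 2)%:E)).
    exact: dyadic_max_sqr_measurable.
  by move=> w _; apply: ereal_nondecreasing_is_cvgn; exact: dyadic_max_sqr_nd.
apply/integrableP; split => //.
under eq_integral => w _.
  rewrite gee0_abs; last by apply: le_trans (maximal_sqr_ge 0 w); rewrite lee_fin sqr_ge0.
  over.
rewrite (monotone_convergence P measurableT dyadic_max_sqr_measurable); last 2 first.
- by move=> m w _; rewrite lee_fin sqr_ge0.
- by move=> w _; exact: dyadic_max_sqr_nd.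
apply: (@le_lt_trans _ _ (4 * v * (Ef + 1))%:E); last exact: ltry.
apply: lime_le; last by apply: nearW => m; exact: dyadic_max_integral.
apply: ereal_nondecreasing_is_cvgn; apply/nondecreasing_seqP => m.
apply: ge0_le_integral => //.
- by move=> w _; rewrite lee_fin sqr_ge0.
- exact: dyadic_max_sqr_measurable.
- exact: dyadic_max_sqr_measurable.
- move=> w _; have /nondecreasing_seqP := @dyadic_max_sqr_nd w; exact.
Qed.

Lemma walk_domination m w : tau w \is a fin_num ->
  let f := fine (tau w) in let S := dyadic_max m w in
  [/\ 0 <= clk m w <= f + 1, `|X m w| <= `|a| * (f + 1) + S &
   `|A m w| <= (f + 1) * (`|a| * (f + 1) + S)].
Proof.
move=> fw f S.
have f0 : 0 <= f by exact: fine_stopping_ge0.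
have dt0 := dyadic_gt0 m.
have c0 : 0 <= clk m w := clock_ge0 (before m ^~ w) (m * 2 ^ m) (ltW dt0).
have c1 : clk m w <= f + 1.
  have /andP[_] := clock_bounds (m * 2 ^ m) dt0 f0 (fun j => beforeE m j fw).
  by move=> /le_trans; apply; rewrite lerD2l dyadic_le1.
(* A point reached by steps begun before [tau] precedes [tau + 1], the mesh being at most 1; it is
   therefore among the points seen by [dyadic_max]. *)
have xle i : (i <= m * 2 ^ m)%N -> i%:R * 2^-1 ^+ m <= f + 1 ->
    (forall l, (l < i)%N -> before m l w) ->
    `|a * (i%:R * 2^-1 ^+ m) + Z (i%:R * 2^-1 ^+ m) w| <= `|a| * (f + 1) + S.
  move=> im i1 Ki; rewrite (le_trans (ler_normD _ _))// lerD//.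
    rewrite normrM ler_wpM2l// ger0_norm// mulr_ge0// ltW//.
  case: i im i1 Ki => [|i] im i1 Ki.
    by rewrite mul0r (weighted0 BM) normr0 running_max_ge0.
  apply: dyadic_max_ge => //; rewrite -(fineK fw) lte_fin.
  have := Ki i (ltnSn i); rewrite beforeE// -(natr1 i) mulrDl mul1r => ltf.
  by rewrite ltrBlDr ltr_leD// dyadic_le1.
split; first by rewrite c0.
- have [i ik [Ki ci _ ->]] := stopped_walk_at_clock BM a b (2^-1 ^+ m) (@before_decr m ^~ w) (m * 2 ^ m).
  by apply: xle => //; rewrite -ci.
- rewrite (walk_areaE BM _ _ _ _ (@before_decr m ^~ w)).
  apply: (@le_trans _ _ (clk m w * (`|a| * (f + 1) + S))); last first.
    by rewrite ler_wpM2r// addr_ge0 ?running_max_ge0// mulr_ge0// addr_ge0.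
  rewrite /stopped_clock mulr_suml; apply: (le_trans (ler_norm_sum _ _ _)).
  apply: ler_sum => j _; case Kj : (before m j w); last by rewrite !mul0r normr0.
  rewrite !mul1r normrM mulrC (ger0_norm (ltW dt0)).
  apply: ler_wpM2l; first exact: ltW.
  apply: xle; first exact: ltnW.
  + by move: Kj; rewrite beforeE// => /ltW/le_trans; apply; rewrite lerDl.
  + move=> l lj; move: Kj; rewrite !beforeE// => /(le_lt_trans _); apply.
    by rewrite ler_pM2r// ler_nat ltnW.
Qed.

Definition stopped_value w : R := a * fine (tau w) + Z (fine (tau w)) w.

Definition stopped_integral w : R :=
  \int[lebesgue_measure]_(u in `[0, fine (tau w)]) (a * u + Z u w).

Lemma weighted_measurable t : 0 <= t -> measurable_fun setT (Z t).
Proof.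
move=> t0; apply: (past_measurable_measurable BM indB t0 n0).
by apply: past_measurable_weighted; rewrite t0 lexx.
Qed.

Lemma stopped_value_measurable :
  measurable_fun setT stopped_value /\ measurable_fun setT stopped_integral.
Proof.
(* Measurability is inherited from the discretized walks. Comparing with [fine (tau w)] instead of
   [tau w] makes them converge at every sample point, including those where [tau] is infinite. *)
pose K m j w := j%:R * 2^-1 ^+ m < fine (tau w).
have mK m j : measurable_fun setT (fun w => (K m j w)%:R : R).
  rewrite (_ : (fun _ => _) = \1_((fun w => fine (tau w)) @^-1` `]j%:R * 2^-1 ^+ m, +oo[)).
    apply: measurable_indic; rewrite -[V in measurable V]setTI.
    exact: fine_stopping_measurable.
  apply/funext => w; rewrite indicE; congr (nat_of_bool _)%:R.
  apply/idP/idP => [Kw|/set_mem]; last by rewrite /= in_itv/= andbT.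
  by apply/mem_set; rewrite /= in_itv/= andbT.
have t0 m j : 0 <= j%:R * (2^-1 : R) ^+ m by rewrite mulr_ge0// ltW// dyadic_gt0.
have mX m k : measurable_fun setT (stopped_walk B a b (2^-1 ^+ m) (K m) k).
  apply: measurable_sum => j; apply: measurable_funM => //.
  apply: measurable_funD => //; apply: measurable_funB; apply: weighted_measurable; exact: t0.
have mA m k : measurable_fun setT (walk_area B a b (2^-1 ^+ m) (K m) k).
  by apply: measurable_sum => j; apply: measurable_funM => //; apply: measurable_funM.
have cvg w := stopped_walk_cvg BM a b (fine_stopping_ge0 w)
  (fun m j => erefl : K m j w = (j%:R * 2^-1 ^+ m < fine (tau w))).
split.
  apply: (measurable_fun_cvg (fun m => mX m (m * 2 ^ m)%N)) => w _.
  by have [_ + _] := cvg w.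
apply: (measurable_fun_cvg (fun m => mA m (m * 2 ^ m)%N)) => w _.
by have [_ _ +] := cvg w.
Qed.

(** One bound for four sequences. With [F = tau + 1], [S] the maximum and [y = |a| F + S], the
    clock, the walk, its square and its area are at most [F], [y], [y^2] and [F y]; moreover
    [F y <= F^2 + y^2] and [y^2 <= 2 a^2 F^2 + 2 S^2]. *)
Definition envelope w : \bar R :=
  ((1 + (2 + 2 * a ^+ 2) * (fine (tau w) + 1) ^+ 2)%:E + 2%:E * maximal_sqr w)%E.

Lemma envelope_integrable : P.-integrable setT envelope.
Proof.
have sf1 := square_integrableD fine_stopping_square (square_integrable_cst P 1).
apply: integrableD => //; last by apply: integrableZl => //; exact: maximal_sqr_integrable.
have i2 := integrable_funZ (2 + 2 * a ^+ 2) sf1.2.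
exact: (integrable_funD (integrable_fun_cst P 1) i2).
Qed.

Lemma walk_envelope m w : tau w \is a fin_num ->
  [/\ (`|clk m w|%:E <= envelope w)%E, (`|X m w|%:E <= envelope w)%E,
   (`|X m w ^+ 2|%:E <= envelope w)%E & (`|A m w|%:E <= envelope w)%E].
Proof.
move=> fw; have [/andP[c0 c1] hX hA] := walk_domination m fw.
have f0 := fine_stopping_ge0 w.
have S0 : 0 <= dyadic_max m w by exact: running_max_ge0.
set f := fine (tau w) in c1 hX hA f0 *; set S := dyadic_max m w in hX hA S0.
have env : ((1 + (2 + 2 * a ^+ 2) * (f + 1) ^+ 2 + 2 * S ^+ 2)%:E <= envelope w)%E.
  rewrite EFinD leeD2l// EFinM lee_wpmul2l// ?lee_fin//.
  exact: maximal_sqr_ge.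
have aa : a ^+ 2 = `|a| ^+ 2 by rewrite real_normK ?num_real.
have F1 : 1 <= f + 1 by rewrite lerDr.
have b0 := normr_ge0 a.
have q : (`|a| * (f + 1) + S) ^+ 2 <= 2 * a ^+ 2 * (f + 1) ^+ 2 + 2 * S ^+ 2.
  by rewrite aa; have := sqr_ge0 (`|a| * (f + 1) - S); nra.
have F2 : f + 1 <= (f + 1) ^+ 2 by nra.
have X2 : X m w ^+ 2 <= (`|a| * (f + 1) + S) ^+ 2.
  by rewrite -[X m w ^+ 2]real_normK ?num_real// lerXn2r ?nnegrE// (le_trans _ hX).
have a20 := sqr_ge0 a.
have F20 := sqr_ge0 (f + 1).
have S20 := sqr_ge0 S.
have aF : 0 <= a ^+ 2 * (f + 1) ^+ 2 by exact: mulr_ge0.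
split; apply: le_trans env; rewrite lee_fin.
- by rewrite ger0_norm//; lra.
- by apply: le_trans hX _; have := sqr_ge0 (`|a| * (f + 1) + S - 1); lra.
- by rewrite ger0_norm ?sqr_ge0//; lra.
- apply: le_trans hA _.
  have := sqr_ge0 (`|a| * (f + 1) + S - (f + 1)); set y := `|a| * (f + 1) + S in q *.
  set F := f + 1 in F20 q aF *; move=> H.
  have : F * y <= F ^+ 2 + y ^+ 2 by nra.
  by lra.
Qed.

(** In the limit of the discrete identities the term [a^2 dt] vanishes. The drift [a] and the
    weights [b] stay arbitrary: the load, the transport cost and, with [a = 0], the martingale part
    are all instances. *)
Theorem stopped_moments :
  [/\ integrable_fun P stopped_value,
      integrable_fun P (fun w => stopped_value w ^+ 2),
      integrable_fun P stopped_integral,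
      \int[P]_w stopped_value w = a * Ef &
      \int[P]_w (stopped_value w ^+ 2) = 2 * a * \int[P]_w stopped_integral w + v * Ef].
Proof.
have dt0 := dyadic_gt0.
have cvgw : {ae P, forall w, [/\ (fun m => clk m w) @ \oo --> fine (tau w),
    (fun m => X m w) @ \oo --> stopped_value w &
    (fun m => A m w) @ \oo --> stopped_integral w]}.
  apply: filterS stopping_ae_finite => w fw.
  exact: (stopped_walk_cvg BM a b (fine_stopping_ge0 w) (fun m j => beforeE m j fw)).
have envw : {ae P, forall w, forall m, [/\ (`|clk m w|%:E <= envelope w)%E,
   (`|X m w|%:E <= envelope w)%E, (`|X m w ^+ 2|%:E <= envelope w)%E &
   (`|A m w|%:E <= envelope w)%E]}.
  by apply: filterS stopping_ae_finite => w fw m; exact: walk_envelope.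
have [mV mI] := stopped_value_measurable.
have iC m := stopped_clock_integrable BM indB (dt0 m) (@before_past m) n0 (m * 2 ^ m).
have sX m := stopped_walk_square_integrable BM indB a b (dt0 m) (@before_past m) n0 (m * 2 ^ m).
have iA m := walk_area_integrable BM indB a b (dt0 m) (@before_past m) n0 (m * 2 ^ m).
have [_ cC] := real_dominated_convergence (fun m => integrable_fun_measurable (iC m).1)
  fine_stopping_measurable (filterS (fun w H => and3_rec (fun h _ _ => h) H) cvgw)
  envelope_integrable (filterS (fun w H m => let: And4 h _ _ _ := H m in h) envw).
have [iV cV] := real_dominated_convergence (fun m => (sX m).1)
  mV (filterS (fun w H => and3_rec (fun _ h _ => h) H) cvgw)
  envelope_integrable (filterS (fun w H m => let: And4 _ h _ _ := H m in h) envw).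
have cvg2 : {ae P, forall w, (fun m => X m w ^+ 2) @ \oo --> stopped_value w ^+ 2}.
  apply: filterS cvgw => w [_ h _].
  by rewrite expr2; under eq_fun do rewrite expr2; exact: cvgM.
have [iV2 cV2] := real_dominated_convergence (fun m => measurable_funX 2 (sX m).1)
  (measurable_funX 2 mV) cvg2
  envelope_integrable (filterS (fun w H m => let: And4 _ _ h _ := H m in h) envw).
have [iI cI] := real_dominated_convergence (fun m => integrable_fun_measurable (iA m))
  mI (filterS (fun w H => and3_rec (fun _ _ h => h) H) cvgw)
  envelope_integrable (filterS (fun w H m => let: And4 _ _ _ h := H m in h) envw).
split => //.
- have e m := stopped_walk_mean BM indB a b (dt0 m) (@before_past m) n0 (m * 2 ^ m).
  apply: cvg_unique cV _ => //; rewrite (funext e).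
  by apply: cvgM => //; exact: cvg_cst.
- have e m := stopped_walk_second_moment BM indB a b (dt0 m) (@before_past m) n0 (m * 2 ^ m).
  apply: cvg_unique cV2 _ => //; rewrite (funext e).
  apply: cvgD; first by apply: cvgM => //; exact: cvg_cst.
  apply: cvgM => //; rewrite -[V in _ --> V]add0r -(mulr0 (a ^+ 2)).
  apply: cvgD; last exact: cvg_cst.
  by apply: cvgM; [exact: cvg_cst|exact: dyadic_cvg0].
Qed.

End wald.

(** * Hitting times of a level by a continuous path *)

Section hitting_time.
Context {R : realType}.
Implicit Types (x : R -> R) (M t : R).

Definition hitting x M : \bar R :=
  ereal_inf (EFin @` [set t : R | 0 < t /\ M <= x t]).

Lemma hitting_ge0 x M : (0 <= hitting x M)%E.
Proof. by apply: le_ereal_inf_tmp => _ [t [t0 _] <-]; rewrite lee_fin ltW. Qed.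

Lemma hitting_le x M t : 0 < t -> M <= x t -> (hitting x M <= t%:E)%E.
Proof. by move=> t0 Mt; apply: ereal_inf_lbound; exists t. Qed.

(** A path below [M] on [[0, t]] stays below a little longer, so the infimum exceeds [t]. Only
    positive times count in [hitting]; [x 0 < M] rules out a witness at time 0. *)
Lemma hitting_leP x M t : continuous x -> x 0 < M -> 0 <= t ->
  (hitting x M <= t%:E)%E <-> exists2 s, 0 <= s <= t & M <= x s.
Proof.
move=> cx x0 t0; split; last first.
  move=> [s /andP[s0 st] Ms]; apply: (@le_trans _ _ s%:E); last by rewrite lee_fin.
  apply: hitting_le => //; rewrite lt_neqAle s0 andbT.
  by apply: contraTneq Ms => <-; rewrite -ltNge.
move=> ht; apply: contrapT => nh.
have below s : 0 <= s -> s <= t -> x s < M.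
  move=> s0 st; rewrite ltNge; apply/negP => Ms; apply: nh; exists s => //.
  by rewrite s0.
have d0 : 0 < M - x t by rewrite subr_gt0 below.
have /cvgrPdist_lt/(_ _ d0)[r /= r0 Hr] := cx t.
suff : ((t + r)%:E <= hitting x M)%E.
  by move=> /le_trans/(_ ht); rewrite lee_fin gerDl leNgt r0.
apply: le_ereal_inf_tmp => _ [s [s0 Ms] <-]; rewrite lee_fin leNgt; apply/negP => sr.
have [st|ts] := leP s t; first by have := below s (ltW s0) st; rewrite ltNge Ms.
have : `|x t - x s| < M - x t.
  by apply: Hr; rewrite /= distrC gtr0_norm ?subr_gt0// ltrBlDl.
by rewrite distrC => /(le_lt_trans (ler_norm _)); rewrite ltrD2r ltNge Ms.
Qed.

Lemma before_hitting x M u : x 0 < M -> 0 <= u -> (u%:E < hitting x M)%E -> x u < M.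
Proof.
move=> x0 u0 uh; rewrite ltNge; apply/negP => Mu.
move: u0; rewrite le_eqVlt => /predU1P[u0|u0]; first by rewrite -u0 leNgt x0 in Mu.
by have := hitting_le u0 Mu; rewrite leNgt uh.
Qed.

Lemma until_hitting x M u : continuous x -> x 0 < M -> 0 <= u ->
  (u%:E <= hitting x M)%E -> x u <= M.
Proof.
move=> cx x0 u0; rewrite le_eqVlt => /predU1P[uh|]; last first.
  by move=> /(before_hitting x0 u0)/ltW.
rewrite leNgt; apply/negP => Mu.
have upos : 0 < u by rewrite lt_neqAle u0 andbT; apply: contraTneq Mu => <-; rewrite -leNgt ltW.
have d0 : 0 < x u - M by rewrite subr_gt0.
have /cvgrPdist_lt/(_ _ d0)[r /= r0 Hr] := cx u.
(* A positive time before [u] and within [r] of it: by continuity the path would already exceed [M]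
   there. *)
pose s := Num.max (u / 2) (u - r / 2).
have su : s < u by rewrite gt_max gtr_pMr// invf_lt1// ltr1n gtrDl oppr_lt0 divr_gt0.
have s0 : 0 < s by rewrite lt_max divr_gt0.
have sr : `|u - s| < r.
  rewrite gtr0_norm ?subr_gt0// ltrBlDl -ltrBlDr lt_max ltrD2l ltrN2.
  by rewrite gtr_pMr// invf_lt1// ltr1n orbT.
have := before_hitting x0 (ltW s0); rewrite -uh lte_fin su => /(_ isT).
apply/negP; rewrite -leNgt.
by have := Hr s sr; move=> /(le_lt_trans (ler_norm _)); rewrite ltrD2l ltrN2 => /ltW.
Qed.

Lemma at_hitting x M : continuous x -> x 0 < M -> hitting x M \is a fin_num ->
  x (fine (hitting x M)) = M.
Proof.
move=> cx x0 fh; have h0 := hitting_ge0 x M.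
have f0 : 0 <= fine (hitting x M) by rewrite fine_ge0.
apply/eqP; rewrite eq_le; apply/andP; split.
  by apply: until_hitting => //; rewrite fineK.
have := (hitting_leP cx x0 f0).1; rewrite fineK// => /(_ (lexx _))[s /andP[s0 st] Ms].
have [st'|ts|es] := ltgtP s (fine (hitting x M)); [|by rewrite leNgt ts in st|by rewrite -es].
have := before_hitting x0 s0; rewrite -(fineK fh) lte_fin st' => /(_ isT).
by rewrite ltNge Ms.
Qed.

(** A dense family of times in [[0, t]] whose index set [rat] does not depend on [t], ready for a
    countable union. *)
Definition clipped_rational t (r : rat) : R := Num.min (Num.max (ratr r) 0) t.

Lemma clipped_rational_itv t r : 0 <= t -> 0 <= clipped_rational t r <= t.
Proof. by move=> t0; rewrite le_min le_max lexx orbT t0 ge_min lexx orbT. Qed.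

Lemma clipped_rational_dense t s e : 0 <= s <= t -> 0 < e ->
  exists r, `|s - clipped_rational t r| < e.
Proof.
move=> /andP[s0 st] e0.
have [|r] := @rat_in_itvoo R (s - e) (s + e).
  by rewrite ltrD2l gtrN.
rewrite in_itv/= => /andP[r1 r2]; exists r; rewrite /clipped_rational.
rewrite ltr_norml; have [h1|h1] := leP (ratr r) 0.
  by have [h2|h2] := leP 0 t; lra.
by have [h2|h2] := leP (ratr r) t; lra.
Qed.

(** The level is reached on [[0, t]] exactly when the maximum of the path, which is attained, is at
    least [M]; by density this can be read at rational times, up to [1 / (k + 1)]. This places the
    event in the past of [t]. *)
Lemma hitting_le_countable x M t : continuous x -> x 0 < M -> 0 <= t ->
  (hitting x M <= t%:E)%E <->
  forall k : nat, exists r, M - k.+1%:R^-1 < x (clipped_rational t r).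
Proof.
move=> cx x0 t0; rewrite (hitting_leP cx x0 t0); split.
  move=> [s st Ms] k.
  have k0 : 0 < k.+1%:R^-1 :> R by rewrite invr_gt0.
  have /cvgrPdist_lt/(_ _ k0)[e /= e0 He] := cx s.
  have [r sr] := clipped_rational_dense st e0; exists r.
  have := le_lt_trans (ler_norm _) (He _ sr) => xsr.
  by rewrite ltrBlDr (le_lt_trans Ms)// -ltrBlDl.
move=> H; have [|c] := @EVT_max R x 0 t t0.
  exact: continuous_subspaceT.
rewrite in_itv/= => ct cmax; exists c => //; rewrite leNgt; apply/negP => cM.
have Mc : 0 < M - x c by rewrite subr_gt0.
have [k Hk] := ltr_add_invr cM; have [r Hr] := H k.
have := cmax (clipped_rational t r); rewrite in_itv/= clipped_rational_itv// => /(_ isT).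
by move=> /(lt_le_trans Hr); rewrite ltrBlDr => /(lt_trans Hk); rewrite ltxx.
Qed.

End hitting_time.

(** * Square integrability of the hitting time *)

Section hitting_stopping_time.
Context {d : measure_display} {T : measurableType d} {R : realType}.
Variable P : probability T R.
Variables (n : nat) (B : 'I_n -> R -> T -> R).
Hypothesis BM : forall i, standard_brownian_motion P (B i).
Hypothesis indB : independent_processes P B.
Hypothesis n0 : (0 < n)%N.
Variables (a : R) (b : 'I_n -> R) (M : R).
Hypotheses (a0 : 0 < a) (M0 : 0 < M).
Local Notation v := (\sum_(i < n) b i ^+ 2).
Local Notation x w := (sample_path B a b w).
Local Notation hit w := (hitting (sample_path B a b w) M).

Let cx w : continuous (x w). Proof. exact: (sample_path_continuous BM). Qed.

Let x0 w : x w 0 < M.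
Proof. by rewrite sample_pathE// mulr0 (weighted0 BM) addr0. Qed.

Lemma hitting_past_event t i : 0 <= t ->
  <<s past_and_others B i t >> [set w | (hit w <= t%:E)%E].
Proof.
move=> t0.
rewrite (_ : [set w | _] = \bigcap_k \bigcup_r
    [set w | M - k.+1%:R^-1 < x w (clipped_rational t r)]); last first.
  apply/seteqP; split=> w /=.
    move=> /(hitting_le_countable (cx (w := w)) (x0 w) t0) h k _.
    by have [r hr] := h k; exists r.
  move=> h; apply/(hitting_le_countable (cx (w := w)) (x0 w) t0) => k.
  by have [r _ hr] := h k Logic.I; exists r.
apply: (@bigcapT_measurable _ (g_sigma_algebraType (past_and_others B i t))) => k.
apply: (@bigcupT_measurable_rat _ (g_sigma_algebraType (past_and_others B i t))) => r.
have q := clipped_rational_itv r t0; set q' := clipped_rational t r in q *.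
have mq : past_measurable B t (fun w => a * q' + weighted B b q' w).
  apply: past_measurableD; first exact: past_measurable_cst.
  exact: past_measurable_weighted.
rewrite (_ : [set w | _] = (fun w => a * q' + weighted B b q' w) @^-1` `]M - k.+1%:R^-1, +oo[).
  by rewrite -[V in measurable V]setTI; apply: mq.
apply/seteqP; case/andP: q => q0 _.
by split=> w /=; rewrite in_itv/= andbT sample_pathE.
Qed.

(** A bounded stopping time, to which the moment identities apply before anything is known about the
    moments of the hitting time itself. *)
Definition truncated_hitting (k : nat) (w : T) : \bar R := Order.min (hit w) k%:R%:E.

Lemma truncated_hitting_fin k w : truncated_hitting k w \is a fin_num.
Proof.
have h0 := hitting_ge0 (x w) M.
rewrite fin_numElt /truncated_hitting lt_min gt_min !ltNyr ltry orbT andbT /= andbT.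
exact: lt_le_trans h0.
Qed.

Lemma truncated_hitting_ge0 k w : (0 <= truncated_hitting k w)%E.
Proof. by rewrite le_min hitting_ge0/= lee_fin. Qed.

Lemma truncated_hitting_past_event k t i : 0 <= t ->
  <<s past_and_others B i t >> [set w | (truncated_hitting k w <= t%:E)%E].
Proof.
move=> t0; have [kt|tk] := leP k%:R t.
  rewrite (_ : [set w | _] = setT).
    exact: (@measurableT _ (g_sigma_algebraType (past_and_others B i t))).
  by apply/seteqP; split=> // w _; rewrite /= ge_min lee_fin kt orbT.
rewrite (_ : [set w | _] = [set w | (hit w <= t%:E)%E]); first exact: hitting_past_event.
by apply/seteqP; split=> w; rewrite /= ge_min [X in _ || X]lee_fin [X in _ || X]leNgt tk orbF.
Qed.

Lemma truncated_hitting_measurable k : measurable_fun setT (truncated_hitting k).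
Proof.
apply: (measurable_stopping BM indB n0); first exact: truncated_hitting_ge0.
exact: truncated_hitting_past_event.
Qed.

Lemma truncated_hitting_square k : (\int[P]_w (truncated_hitting k w ^+ 2) < +oo)%E.
Proof.
apply: (@le_lt_trans _ _ (\int[P]_w (k%:R ^+ 2)%:E)%E); last first.
  by rewrite integral_cst//= probability_setT mule1 ltry.
apply: ge0_le_integral => //.
- by move=> w _; rewrite expe2 mule_ge0// truncated_hitting_ge0.
- under eq_fun do rewrite expe2.
  by apply: emeasurable_funM; exact: truncated_hitting_measurable.
move=> w _; rewrite expe2 expr2 EFinM.
by apply: lee_pmul; rewrite ?truncated_hitting_ge0// ge_min lexx orbT.
Qed.

(* The sample_path stays below [M] until it hits [M], so the moment identities bound the mean of
   the truncated time, then the second moments of the stopped sample_path and of its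
   martingale part, hence that of [a * tau]. *)
Lemma truncated_hitting_square_le k :
  (\int[P]_w (truncated_hitting k w ^+ 2) <= ((4 * a * M + 4 * v) * (M / a) / a ^+ 2)%:E)%E.
Proof.
set tau := truncated_hitting k.
have tau0 : forall w, (0 <= tau w)%E by exact: truncated_hitting_ge0.
have tauS t i : 0 <= t -> <<s past_and_others B i t >> [set w | (tau w <= t%:E)%E].
  exact: truncated_hitting_past_event.
have tau2 : (\int[P]_w (tau w ^+ 2) < +oo)%E by exact: truncated_hitting_square.
have ftau w : (fine (tau w))%:E = tau w by rewrite fineK// truncated_hitting_fin.
have f0 w : 0 <= fine (tau w) by rewrite fine_ge0.
have fhit w : ((fine (tau w))%:E <= hit w)%E by rewrite ftau ge_min lexx.
have sf := fine_stopping_square BM indB n0 tau0 tauS tau2.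
have if1 := square_integrable_integrable sf.
have [iS iS2 iI ES ES2] := stopped_moments BM indB n0 tau0 tauS tau2 a b.
have [_ iZ2 _ _ EZ2] := stopped_moments BM indB n0 tau0 tauS tau2 0 b.
have SM w : stopped_value B tau a b w <= M.
  by rewrite /stopped_value -sample_pathE//; apply: until_hitting.
have IM w : stopped_integral B tau a b w <= M * fine (tau w).
  rewrite /stopped_integral.
  have -> : \int[lebesgue_measure]_(u in `[0, fine (tau w)]) (a * u + weighted B b u w) =
      \int[lebesgue_measure]_(u in `[0, fine (tau w)]) x w u.
    apply: eq_Rintegral => u.
    by rewrite inE/= in_itv/= => /andP[u0 _]; rewrite sample_pathE.
  have -> : M * fine (tau w) = \int[lebesgue_measure]_(u in `[0, fine (tau w)]) M.
    rewrite Rintegral_cst//= lebesgue_measure_itv/= lte_fin.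
    case: ltP => /= h; first by rewrite subr0.
    by rewrite (_ : fine (tau w) = 0)//; apply/eqP; rewrite eq_le h f0.
  apply: le_Rintegral => //.
  - exact: continuous_integrable_itv.
  - by apply: (@continuous_integrable_itv _ (fun=> M)) => u; exact: cvg_cst.
  move=> u; rewrite /= in_itv/= => /andP[u0 uf].
  by apply: until_hitting => //; apply: le_trans (fhit w); rewrite lee_fin.
set Ef := \int[P]_w fine (tau w) in ES ES2 EZ2 *.
have Ef0 : 0 <= Ef by apply: Rintegral_ge0.
have EM (c : R) : \int[P]_w c = c by rewrite Rintegral_cst//= probability_setT mulr1.
have EfM : Ef <= M / a.
  rewrite ler_pdivlMr// mulrC -ES -[leRHS]EM; apply: le_Rintegral => //.
  exact: integrable_fun_cst.
have EI : \int[P]_w stopped_integral B tau a b w <= M * Ef.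
  rewrite /Ef -RintegralZl//; apply: le_Rintegral => //.
  exact: integrable_funZ.
have v0 : 0 <= v by apply: sumr_ge0 => i _; exact: sqr_ge0.
(* With [y = a tau] and [z] the martingale part, [2 (y + z)^2 + 2 z^2 - y^2] is the square of
   [y + 2 z]. *)
have key : a ^+ 2 * \int[P]_w (fine (tau w) ^+ 2) <=
    2 * \int[P]_w (stopped_value B tau a b w ^+ 2) +
    2 * \int[P]_w (stopped_value B tau 0 b w ^+ 2).
  have j1 := integrable_funZ 2 iS2; have j2 := integrable_funZ 2 iZ2.
  have j3 := integrable_funZ (a ^+ 2) sf.2.
  rewrite -!RintegralZl//; last exact: sf.2.
  rewrite -RintegralD//; apply: le_Rintegral => //.
    exact: integrable_funD.
  move=> w _; rewrite /stopped_value mul0r add0r -exprMn.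
  set y := a * _; set z := weighted _ _ _ _.
  by have := sqr_ge0 (y + 2 * z); lra.
have intE : (\int[P]_w (tau w ^+ 2) = (\int[P]_w (fine (tau w) ^+ 2))%:E)%E.
  rewrite /Rintegral fineK; last exact: integrable_fin_num sf.2.
  by apply: eq_integral => w _; rewrite -ftau.
rewrite intE lee_fin ler_pdivlMr ?exprn_gt0// mulrC (le_trans key)//.
rewrite ES2 EZ2 mulr0 mul0r add0r.
(* The two second moments are at most [(2 a M + v) E tau] and [v E tau]; doubled, they add up to
   this bound, and [E tau <= M / a] finishes. *)
apply: (@le_trans _ _ ((4 * a * M + 4 * v) * Ef)).
  have : a * \int[P]_w stopped_integral B tau a b w <= a * (M * Ef) by rewrite ler_wpM2l// ltW.
  by lra.
apply: ler_wpM2l => //; apply: addr_ge0; last exact: mulr_ge0.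
by rewrite !mulr_ge0// ltW.
Qed.

(** Monotone convergence in the truncation level, with a bound independent of [k]. Where the level
    is never hit, the truncated squares [k^2] are unbounded, so the limit dominates there too. *)
Lemma hitting_square_integrable : (\int[P]_w (hit w ^+ 2) < +oo)%E.
Proof.
have tnd w : nondecreasing_seq (fun k => truncated_hitting k w ^+ 2)%E.
  apply/nondecreasing_seqP => k; rewrite !expe2.
  have le1 : (truncated_hitting k w <= truncated_hitting k.+1 w)%E.
    by rewrite /truncated_hitting le_min !ge_min lexx /= lee_fin ler_nat leqnSn orbT.
  by apply: lee_pmul => //; exact: truncated_hitting_ge0.
have tm k : measurable_fun setT (fun w => truncated_hitting k w ^+ 2)%E.
  under eq_fun do rewrite expe2.
  by apply: emeasurable_funM; exact: truncated_hitting_measurable.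
have tge k w : (0 <= truncated_hitting k w ^+ 2)%E.
  by rewrite expe2 mule_ge0// truncated_hitting_ge0.
have mh : measurable_fun setT (fun w => hit w).
  apply: (measurable_stopping BM indB n0); first by move=> w; exact: hitting_ge0.
  exact: hitting_past_event.
have lim_ge w : (hit w ^+ 2 <= limn (fun k => truncated_hitting k w ^+ 2))%E.
  rewrite (cvg_lim _ (ereal_nondecreasing_cvgn (tnd w)))//.
  have h0 := hitting_ge0 (x w) M.
  have [hf|] := boolP (hit w \is a fin_num).
    apply: ereal_sup_ubound; exists (Num.truncn (fine (hit w))).+1 => //.
    rewrite /truncated_hitting (min_idPl _)// -(fineK hf) lee_fin ltW//.
    exact: truncnS_gt.
  rewrite ge0_fin_numE// -leNgt leye_eq => /eqP hy.
  have tk k : ((k%:R ^+ 2)%:E <= ereal_sup (range (fun k => truncated_hitting k w ^+ 2)))%E.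
    apply: ereal_sup_ubound; exists k => //.
    by rewrite /truncated_hitting hy (min_idPr (leey _)) expe2 -EFinM -expr2.
  rewrite hy expe2 mulyy; case E : (ereal_sup _) tk => [r| |] tk //; last first.
    by have := tk 0%N.
  have := tk (Num.truncn `|r|).+1; rewrite lee_fin leNgt => /negP[].
  apply: (le_lt_trans (ler_norm r)); apply: (lt_le_trans (truncnS_gt _)).
  by rewrite expr2 ler_peMr// ler1n.
apply: (@le_lt_trans _ _ (\int[P]_w limn (fun k => truncated_hitting k w ^+ 2))%E).
  apply: ge0_le_integral => //.
  - by move=> w _; rewrite expe2 mule_ge0// hitting_ge0.
  - by under eq_fun do rewrite expe2; apply: emeasurable_funM.
  - apply: (emeasurable_fun_cvg (fun k w => truncated_hitting k w ^+ 2)%E) => //.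
    by move=> w _; exact: ereal_nondecreasing_is_cvgn.
rewrite (monotone_convergence P measurableT tm)//.
apply: (@le_lt_trans _ _ ((4 * a * M + 4 * v) * (M / a) / a ^+ 2)%:E); last exact: ltry.
apply: lime_le; last by apply: nearW => k; exact: truncated_hitting_square_le.
apply: ereal_nondecreasing_is_cvgn; apply/nondecreasing_seqP => k.
apply: ge0_le_integral => // w _.
by have /nondecreasing_seqP := tnd w; exact.
Qed.

End hitting_stopping_time.

(** * The average cost in terms of the stopped load *)

Section cost.
Context {d : measure_display} {T : measurableType d} {R : realType}.
Variable P : probability T R.
Variables (n : nat) (B : 'I_n -> R -> T -> R).
Hypothesis BM : forall i, standard_brownian_motion P (B i).
Hypothesis indB : independent_processes P B.
Hypothesis n0 : (0 < n)%N.
Variables (D sigma c omega : 'I_n -> R) (A_D : R).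
Local Notation N := (demand D sigma B).
Local Notation drift := (\sum_(i < n) omega i * D i).
Local Notation load := (fun i => omega i * sigma i).
Local Notation v := (\sum_(i < n) load i ^+ 2).
Hypothesis drift0 : 0 < drift.

Lemma weighted_demand (e : 'I_n -> R) t w :
  \sum_(i < n) e i * N i t w =
  (\sum_(i < n) e i * D i) * t + weighted B (fun i => e i * sigma i) t w.
Proof.
rewrite /weighted mulr_suml -big_split /=; apply: eq_bigr => i _.
by rewrite /demand; ring.
Qed.

Lemma irp_cycleE M w : irp_cycle omega N M w = hitting (sample_path B drift load w) M.
Proof.
congr ereal_inf; apply/seteqP; split=> _ [t [t0 Mt] <-]; exists t => //; split => //.
  by rewrite (sample_pathE _ _ _ _ (ltW t0)) -weighted_demand.
by rewrite weighted_demand -(sample_pathE _ _ _ _ (ltW t0)).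
Qed.

Variable tau : T -> \bar R.
Hypothesis tau0 : forall w, (0 <= tau w)%E.
Hypothesis tauS : forall (t : R) i, 0 <= t ->
  <<s past_and_others B i t >> [set w | (tau w <= t%:E)%E].
Hypothesis tau2 : (\int[P]_w (tau w ^+ 2) < +oo)%E.
Local Notation m := (\int[P]_w fine (tau w)).
Hypothesis m0 : 0 < m.

Lemma continuous_integrable_demand i w (f : R) :
  lebesgue_measure.-integrable `[0, f] (EFin \o (fun u => omega i * N i u w)).
Proof.
(* Weights supported at [i] turn the single term [omega i * N i] into a sample path, whose
   continuity is known. *)
pose b j := if j == i then omega i * sigma i else 0.
have ip : lebesgue_measure.-integrable `[0, f] (EFin \o sample_path B (omega i * D i) b w).
  by apply: continuous_integrable_itv; exact: (sample_path_continuous BM).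
apply: eq_integrable ip => //.
  move=> u; rewrite inE/= in_itv/= => /andP[u0 _]; rewrite sample_pathE//; congr EFin.
  rewrite /weighted (bigD1 i)//= big1 ?addr0; first by rewrite /b eqxx /demand; ring.
  by move=> j /negbTE ji; rewrite /b ji mul0r.
Qed.

Lemma holding_cost w : \sum_(i < n)
    \int[lebesgue_measure]_(u in `[0%R, fine (tau w)]) (omega i * N i u w) =
  stopped_integral B tau drift load w.
Proof.
rewrite /stopped_integral.
have -> : \int[lebesgue_measure]_(u in `[0%R, fine (tau w)]) (drift * u + weighted B load u w) =
   \int[lebesgue_measure]_(u in `[0%R, fine (tau w)]) (\sum_(i < n) omega i * N i u w).
  by apply: eq_Rintegral => u _; rewrite weighted_demand.
have iN := fun i => continuous_integrable_demand i w (fine (tau w)).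
elim: (index_enum 'I_n) => [|i r IH].
  rewrite big_nil; under eq_Rintegral do rewrite big_nil.
  by rewrite Rintegral_cst// mul0r.
rewrite big_cons IH; under [RHS]eq_Rintegral do rewrite big_cons.
rewrite RintegralD//.
rewrite (_ : EFin \o _ = fun u => (\sum_(j <- r) (omega j * N j u w)%:E)%E); last first.
  by apply/funext => u; rewrite /= sumEFin.
by apply: integrable_sum => // j _; exact: iN.
Qed.

(** Besides the mean cycle [m], the policy enters only through the second moment of the load at
    clearing, so policies with equal [m] are compared by that number alone. *)
Lemma average_costE : average_cost P A_D c omega N tau =
  ((A_D + (\sum_(i < n) c i * D i) * m +
    (\int[P]_w (stopped_value B tau drift load w ^+ 2) - v * m) / (2 * drift)) / m)%:E.
Proof.
rewrite /average_cost.
have [iC _ _ EC _] := stopped_moments BM indB n0 tau0 tauS tau2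
  (\sum_(i < n) c i * D i) (fun i => c i * sigma i).
have [_ _ iI _ EI] := stopped_moments BM indB n0 tau0 tauS tau2 drift load.
have -> : ('E_P[fun w => (\sum_(i < n) c i * N i (fine (tau w)) w)%R] =
    ((\sum_(i < n) c i * D i) * m)%R%:E)%E.
  rewrite unlock -EC /Rintegral fineK; last exact: integrable_fin_num iC.
  by apply: eq_integral => w _; rewrite weighted_demand.
have -> : ('E_P[fun w => (\sum_(i < n)
        \int[lebesgue_measure]_(u in `[0%R, fine (tau w)]) (omega i * N i u w))%R] =
    (\int[P]_w stopped_integral B tau drift load w)%R%:E)%E.
  rewrite unlock /Rintegral fineK; last exact: integrable_fin_num iI.
  by apply: eq_integral => w _; rewrite holding_cost.
rewrite (integral_fine_stopping BM indB n0 tau0 tauS tau2) inver gt_eqF//.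
rewrite -!EFinD -EFinM; congr EFin; congr (_ / _); congr (_ + _).
by rewrite EI addrK mulrAC divff ?mul1r// gt_eqF// mulr_gt0.
Qed.

Lemma stopped_value_variance :
  (drift * m) ^+ 2 <= \int[P]_w (stopped_value B tau drift load w ^+ 2).
Proof.
have [iV iV2 _ EV _] := stopped_moments BM indB n0 tau0 tauS tau2 drift load.
set k := drift * m in EV *.
have : 0 <= \int[P]_w (stopped_value B tau drift load w ^+ 2 +
    (- (2 * k) * stopped_value B tau drift load w + k ^+ 2)).
  apply: Rintegral_ge0 => w _.
  by have := sqr_ge0 (stopped_value B tau drift load w - k); lra.
have i1 := integrable_funZ (- (2 * k)) iV.
have i2 := integrable_fun_cst P (k ^+ 2).
rewrite RintegralD//; last exact: integrable_funD.
rewrite RintegralD// RintegralZl// EV Rintegral_cst//= probability_setT mulr1.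
by rewrite -subr_ge0; lra.
Qed.

End cost.

(** By continuity the stopped load equals [M] almost surely, and the first identity turns this into
    the mean of the hitting time. *)
Lemma hitting_moments (d : measure_display) (T : measurableType d) (R : realType)
    (P : probability T R) (n : nat) (B : 'I_n -> R -> T -> R)
    (BM : forall i, standard_brownian_motion P (B i))
    (indB : independent_processes P B) (n0 : (0 < n)%N)
    (a M : R) (b : 'I_n -> R) (a0 : 0 < a) (M0 : 0 < M) :
  let tau := fun w => hitting (sample_path B a b w) M in
  \int[P]_w fine (tau w) = M / a /\
  \int[P]_w (stopped_value B tau a b w ^+ 2) = M ^+ 2.
Proof.
move=> tau.
have tau0 w : (0 <= tau w)%E by exact: hitting_ge0.
have tauS t i : 0 <= t -> <<s past_and_others B i t >> [set w | (tau w <= t%:E)%E].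
  exact: (hitting_past_event BM).
have tau2 : (\int[P]_w (tau w ^+ 2) < +oo)%E by exact: (hitting_square_integrable BM).
have [iV iV2 _ EV _] := stopped_moments BM indB n0 tau0 tauS tau2 a b.
have VM : {ae P, forall w, stopped_value B tau a b w = M}.
  apply: filterS (stopping_ae_finite BM indB n0 tau0 tauS tau2) => w fw.
  rewrite /stopped_value -sample_pathE ?fine_ge0//; apply: at_hitting => //.
    exact: (sample_path_continuous BM).
  by rewrite sample_pathE// mulr0 (weighted0 BM) addr0.
have Ecst (k : R) : (\int[P]_w k%:E = k%:E)%E.
  by rewrite integral_cst//= probability_setT mule1.
split.
  apply: (mulfI (lt0r_neq0 a0)); rewrite -EV mulrC divfK ?gt_eqF//.
  rewrite /Rintegral -[RHS]/(fine M%:E) -Ecst; congr fine; apply: ae_eq_integral => //.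
    by apply/measurable_EFinP; exact: integrable_fun_measurable iV.
  by apply: filterS VM => w -> _.
rewrite /Rintegral -[RHS]/(fine (M ^+ 2)%:E) -Ecst; congr fine; apply: ae_eq_integral => //.
  by apply/measurable_EFinP; exact: integrable_fun_measurable iV2.
by apply: filterS VM => w -> _.
Qed.

Theorem theorem20 (d : measure_display) (T : measurableType d) (R : realType)
    (P : probability T R) (n : nat) (hn : (1 <= n)%N)
    (B : 'I_n -> R -> T -> R)
    (hB : forall i, standard_brownian_motion P (B i))
    (hindep : independent_processes P B)
    (D sigma c omega : 'I_n -> R) (A_D : R)
    (hD : forall i, 0 < D i) (hsigma : forall i, 0 < sigma i)
    (homega : forall i, 0 < omega i) (hA_D : 0 < A_D)
    (Mstar : R) (hMstar : 0 < Mstar)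
    (hmin : forall M : R, 0 < M ->
      (average_cost P A_D c omega (demand D sigma B)
         (irp_cycle omega (demand D sigma B) Mstar)
       <= average_cost P A_D c omega (demand D sigma B)
         (irp_cycle omega (demand D sigma B) M))%E)
    (tau : T -> \bar R)
    (htau : stopping_time (natural_filtration (demand D sigma B)) tau)
    (htau_pos : (0 < \int[P]_w tau w)%E)
    (htau_sq : (\int[P]_w (tau w ^+ 2) < +oo)%E) :
  (average_cost P A_D c omega (demand D sigma B)
     (irp_cycle omega (demand D sigma B) Mstar)
   <= average_cost P A_D c omega (demand D sigma B) tau)%E.
Proof.
have n0 : (0 < n)%N by exact: hn.
have [tau0 tauF] := htau.
have tauS (t : R) i : 0 <= t -> <<s past_and_others B i t >> [set w | (tau w <= t%:E)%E].
  by move=> t0; apply: natural_filtration_past; exact: tauF.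
pose drift := \sum_(i < n) omega i * D i.
have drift0 : 0 < drift.
  rewrite /drift (bigD1 (Ordinal n0))//= ltr_pwDl ?mulr_gt0// sumr_ge0// => i _.
  by rewrite mulr_ge0// ltW.
pose load i := omega i * sigma i.
have intE := integral_fine_stopping hB hindep n0 tau0 tauS htau_sq.
set m := \int[P]_w fine (tau w) in intE.
have m0 : 0 < m by move: htau_pos; rewrite intE lte_fin.
have M0 : 0 < drift * m by exact: mulr_gt0.
apply: le_trans (hmin _ M0) _.
have [Em Eq] := hitting_moments hB hindep n0 load drift0 M0.
have irpE := funext (fun w => irp_cycleE B D sigma omega (drift * m) w).
rewrite irpE (average_costE hB hindep n0 sigma c A_D drift0 tau0 tauS htau_sq m0).
rewrite (average_costE hB hindep n0 sigma c A_D drift0 _ _ _ _); last 4 first.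
- by move=> w; exact: hitting_ge0.
- by move=> t i t0; exact: (hitting_past_event hB).
- exact: (hitting_square_integrable hB).
- by rewrite Em divr_gt0.
(* Here [Em] reads [drift * m / drift], that is [m]: all terms of the two costs cancel except the
   second moments of the final load. *)
rewrite lee_fin Em Eq mulrAC divff ?gt_eqF// mul1r.
rewrite ler_pM2r ?invr_gt0// lerD2l ler_pM2r ?invr_gt0 ?mulr_gt0// lerD2r.
exact: (stopped_value_variance hB hindep n0 D sigma omega tau0 tauS htau_sq).
Qed.
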